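(* Let $T:\mathbb{T}^2\to\mathbb{T}^2$, $T(\omega_1,\omega_2)=(2\omega_1+\omega_2,\ \omega_1+\omega_2) \bmod \mathbb{Z}^2$, be the Cat Map, and let $\vec u=\left(\frac{1+\sqrt5}{2},\,1\right)^t$ be its unstable eigenvector. Let $v:\mathbb{T}^2\to\mathbb{R}$ be a bounded measurable function such that (i) $v\in C^1([0,1)^2,\mathbb{R})$, and (ii) there is a constant $c>0$ such that $D_{\vec u}v(\omega)>c$ for all $\omega\in\mathbb{T}^2$. Consider the family of Schrödinger operators $[H_{\lambda,v,\omega}\psi]_n=\psi_{n+1}+\psi_{n-1}+\lambda v(T^n\omega)\psi_n$ on $\ell^2(\mathbb{Z})$ and let $L(E;\lambda)$ be the Lyapunov exponent of the associated Schrödinger cocycle at energy $E$. Then there exists $C_0=C_0(v)>0$ such that for every $\lambda>0$ $$L(E;\lambda)>\log\lambda-C_0\quad\text{for all }E\in\mathbb{R}.$$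
   Context: $\mathbb{T}^2=\mathbb{R}^2/\mathbb{Z}^2$ is identified with the fundamental domain $[0,1)^2$ and carries Lebesgue measure $\mu$. A function $v$ on $\mathbb{T}^2$ is regarded as a function on $[0,1)^2$; condition (i) concerns $v$ on $[0,1)^2$ only, so $v$ may be discontinuous as a function on $\mathbb{T}^2$ across the boundary of the fundamental domain. $D_{\vec u}v=u_1\partial_{\omega_1}v+u_2\partial_{\omega_2}v$ is the directional derivative ($\vec u$ is not normalized). For $E\in\mathbb{R}$, $\lambda>0$, put $$A^{(E-\lambda v)}(\omega)=\begin{pmatrix}E-\lambda v(\omega)&-1\\1&0\end{pmatrix}\in\mathrm{SL}(2,\mathbb{R}),\qquad A_n^{(E-\lambda v)}(\omega)=A^{(E-\lambda v)}(T^{n-1}\omega)\cdots A^{(E-\lambda v)}(\omega)\quad (n\ge1).$$ The Lyapunov exponent is $$L(E;\lambda)=\lim_{n\to\infty}\frac1n\int_{\mathbb{T}^2}\log\|A_n^{(E-\lambda v)}(\omega)\|\,d\mu(\omega)=\inf_{n\ge1}\frac1n\int_{\mathbb{T}^2}\log\|A_n^{(E-\lambda v)}(\omega)\|\,d\mu(\omega)\ge 0.$$ The constant $C_0$ depends only on $v$ (not on $\lambda$ or $E$). *)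

(* Defs.v *)
From HB Require Import structures.
From mathcomp Require Import all_boot all_order all_algebra.
From mathcomp Require Import all_classical all_reals all_analysis.

Set Implicit Arguments.
Unset Strict Implicit.
Unset Printing Implicit Defensive.

Import Order.TTheory GRing.Theory Num.Theory.
Import numFieldNormedType.Exports.

Local Open Scope classical_set_scope.
Local Open Scope ring_scope.

Section Torus.
Context {R : realType}.

(* The torus R^2/Z^2 is represented by its fundamental domain [0,1)^2 inside
   R * R.  A function on the torus is a function on R * R of which only the
   values on [torus] are ever used. *)
Definition torus : set (R * R) := `[0, 1[ `*` `[0, 1[.

(* Representative in [0,1) of the class of x modulo Z. *)
Definition mod1 (x : R) : R := x - (Num.floor x)%:~R.

Definition cat_map (w : R * R) : R * R :=
  (mod1 (2 * w.1 + w.2), mod1 (w.1 + w.2)).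

(* Lebesgue measure on the plane; it is restricted to [torus] by integrating
   over that set. *)
Definition lebesgue2 :
    {measure set (measurableTypeR R * measurableTypeR R) -> \bar R} :=
  (lebesgue_measure \x lebesgue_measure)%E.

End Torus.

Section Differentiability.
Context {R : realType}.

(* Derivative at x relative to a set D: the limit of the slopes as y tends to
   x within D \ {x}.  It is the usual derivative if x is interior to D, and
   the right derivative if x = a and D = [a,b). *)
Definition slope_at (f : R -> R) (x y : R) : R := (f y - f x) / (y - x).

Definition derivable_within (D : set R) (f : R -> R) (x : R) : Prop :=
  cvg (slope_at f x y @[y --> within D x^']).

Definition derive_within (D : set R) (f : R -> R) (x : R) : R :=
  lim (slope_at f x y @[y --> within D x^']).

(* Partial derivatives on [0,1)^2, one-sided where a coordinate is 0. *)
Definition partial1 (v : R * R -> R) (w : R * R) : R :=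
  derive_within `[0, 1[ (fun x => v (x, w.2)) w.1.

Definition partial2 (v : R * R -> R) (w : R * R) : R :=
  derive_within `[0, 1[ (fun y => v (w.1, y)) w.2.

(* v belongs to C^1([0,1)^2, R).  Nothing is required across the boundary of
   the fundamental domain, nor on the growth of the derivatives near the sides
   where a coordinate tends to 1. *)
Definition C1_torus (v : R * R -> R) : Prop :=
  [/\ {within torus, continuous v},
      (forall w, torus w ->
         derivable_within `[0, 1[ (fun x => v (x, w.2)) w.1 /\
         derivable_within `[0, 1[ (fun y => v (w.1, y)) w.2),
      {within torus, continuous (partial1 v)} &
      {within torus, continuous (partial2 v)}].

Definition dir_deriv (u : R * R) (v : R * R -> R) (w : R * R) : R :=
  u.1 * partial1 v w + u.2 * partial2 v w.

Definition unstable_dir : R * R := ((1 + Num.sqrt 5) / 2, 1).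

End Differentiability.

Section Cocycle.
Context {R : realType}.

Definition euclid_norm n (x : 'cV[R]_n) : R :=
  Num.sqrt (\sum_i x i 0 ^+ 2).

(* Euclidean operator norm; the norm `|A| that the library puts on matrices is
   the largest absolute value of an entry. *)
Definition op_norm n (A : 'M[R]_n) : R :=
  sup [set euclid_norm (A *m x) | x in [set x : 'cV[R]_n | euclid_norm x = 1]].

Definition schrodinger_mx (v : R * R -> R) (lam E : R) (w : R * R) : 'M[R]_2 :=
  \matrix_(i < 2, j < 2)
    if i == 0 then (if j == 0 then E - lam * v w else -1)
    else (if j == 0 then 1 else 0).

Fixpoint cocycle (v : R * R -> R) (lam E : R) (n : nat) (w : R * R) : 'M[R]_2 :=
  if n is m.+1
  then schrodinger_mx v lam E (iter m cat_map w) *m cocycle v lam E m w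
  else 1%:M.

(* The index n = 0 (where 0^-1 = 0) is irrelevant to the limit. *)
Definition lyapunov (v : R * R -> R) (lam E : R) : R :=
  limn (fun n : nat => n%:R^-1 *
    Rintegral lebesgue2 torus (fun w => ln (op_norm (cocycle v lam E n w)))).

End Cocycle.

(* Main.v *)
Require Import Defs.
From HB Require Import structures.
From mathcomp Require Import all_boot all_order all_algebra.
From mathcomp Require Import all_classical all_reals all_analysis.
From mathcomp Require Import measurable_realfun ring lra zify.
Import Order.TTheory GRing.Theory Num.Theory.
Import numFieldNormedType.Exports.
Local Open Scope classical_set_scope.
Local Open Scope ring_scope.

(* Along the unstable direction (phi, 1), phi^2 = phi + 1, n iterations of the
   cat map expand by phi^(2n), so on a segment that does not cross the boundary
   of the fundamental domain E - lam v(T^n .) decreases at speed at least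
   lam c phi^(2n).  With psi_n the (0,0) entry of A_n, the ratio
   m_n = psi_n / psi_(n-1) obeys m_(n+1) = E - lam v(T^n .) - 1 / m_n and hence
   decreases at that speed too, jumping from -oo to +oo whenever m_n changes
   sign.  An integer counter of these passages and of the boundary crossings
   makes (counter, - m_n) lexicographically monotone along the whole unstable
   segment.  The counter increases by at most a sum of O(phi^(2k)), k <= n, that
   is by O(phi^(2n)), and |m_(n+1)| <= d holds, for each value of the counter,
   on a set of diameter at most 2 d / (lam c phi^(2n)).  Integrating over the
   segments, |psi_(n+1)| <= d |psi_n| holds on a set of measure O(d / lam), so
   the integral of log |psi_(n+1) / psi_n| is at least log lam - C, and
   |psi_n| <= |A_n| telescopes.  The limit defining the exponent exists by
   Fekete's lemma, T being measure preserving as a composition of two shears. *)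

Set Implicit Arguments.
Unset Strict Implicit.
Unset Printing Implicit Defensive.

(** * Oscillation of solutions *)

Fixpoint solution (R : realFieldType) (a : nat -> R) (n : nat) : R * R :=
  if n is m.+1
  then (a m * (solution a m).1 - (solution a m).2, (solution a m).1)
  else (1, 0).

(* [solution a n] is the pair (psi_n, psi_(n-1)), whose ratio is +oo when
   psi_(n-1) = 0.  As [t] increases the ratio runs down from +oo; once it is
   <= 0 the next ratio has passed through -oo = +oo, which [winding] counts. *)
Definition past_zero (R : realFieldType) (p : R * R) : bool :=
  (p.2 != 0) && (p.1 * p.2 <= 0).

Fixpoint winding (R : realFieldType) (a : nat -> R) (D : nat -> int) (n : nat)
    : int :=
  if n is m.+1
  then winding a D m + (past_zero (solution a m))%:Z + D m
  else 0.

Section Oscillation.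
Context {R : realFieldType}.
Implicit Types (a : nat -> R) (D : nat -> int) (p q : R * R) (k l : int).

(* Lexicographic order on (counter, - ratio), with a gap [d] between the ratios
   at equal counters; the ratio +oo comes first. *)
Definition precedes (d : R) k p l q : Prop :=
  k < l \/ k = l /\ (p.2 = 0 \/ [/\ p.2 != 0, q.2 != 0 &
                                    q.1 / q.2 + d <= p.1 / p.2]).

(** The recursion is invertible and starts from (1, 0), so it never reaches (0, 0). *)
Lemma solution_neq0 a n : (solution a n).2 = 0 -> (solution a n).1 != 0.
Proof.
elim: n => [|n IHn] /=; first by rewrite oner_eq0.
by move=> x0; rewrite x0 mulr0 sub0r oppr_eq0; apply: contra_eqN x0 => /eqP/IHn.
Qed.

Lemma divr_le0E (u w : R) : w != 0 -> (u / w <= 0) = (u * w <= 0).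
Proof.
move=> w0; rewrite -(@pmulr_lle0 _ (w ^+ 2) (u / w)) ?exprn_even_gt0 //.
by rewrite expr2 mulrA mulfVK.
Qed.

Lemma divr_gt0E (u w : R) : w != 0 -> (0 < u / w) = (0 < u * w).
Proof. by move=> w0; rewrite !ltNge divr_le0E. Qed.

(** One step sends a ratio m to al - 1 / m. Inversion reverses the order on each side of 0, and
    [past_zero] tells the sides apart: whenever the two ratios lie on different sides, the counters
    account for it. The new gap [d] comes from the coefficients alone, which are compared only if
    [D = E]. *)
Lemma precedes_step {al be d : R} {D E : int} {k p l q} :
  (p.2 = 0 -> p.1 != 0) -> (q.2 = 0 -> q.1 != 0) ->
  D <= E -> (D = E -> be + d <= al) -> precedes 0 k p l q ->
  precedes d (k + (past_zero p)%:Z + D) (al * p.1 - p.2, p.1)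
             (l + (past_zero q)%:Z + E) (be * q.1 - q.2, q.1).
Proof.
case: p q => [x y] [x' y'] /= p0 q0 DE ald kl.
have frac (b u w : R) : u != 0 -> (b * u - w) / u = b - w / u.
  by move=> u0; rewrite mulrBl mulfK.
(* The flags are added first, [D] and [E] later. At equal counters the reciprocals of the ratios are
   ordered; [x = 0] means that the new ratio is +oo. *)
have key : k + (past_zero (x, y))%:Z <= l + (past_zero (x', y'))%:Z /\
    (k + (past_zero (x, y))%:Z = l + (past_zero (x', y'))%:Z ->
     x = 0 \/ [/\ x != 0, x' != 0 & y / x <= y' / x']).
  (* Without the flag the ratio lies in (0, +oo] and its reciprocal is nonnegative, being 0 when the
     ratio is +oo. *)
  have nflag : ~~ past_zero (x', y') -> x' != 0 /\ 0 <= y' / x'.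
    rewrite /past_zero/= negb_and negbK -ltNge => /orP[/eqP y0|h].
      by rewrite y0 mul0r q0.
    have x0 : x' != 0 by apply: contraTneq h => ->; rewrite mul0r ltxx.
    by split=> //; apply: ltW; rewrite divr_gt0E// mulrC.
  have flag : past_zero (x, y) -> x != 0 -> y / x <= 0.
    by rewrite /past_zero/= => /andP[_ h] x0; rewrite divr_le0E// mulrC.
  case: kl => [kl|[-> [y0|[y0 y'0]]]].
  (* If [k < l], the counters can become equal only when the first pair alone has its flag set; 0
     then separates the two reciprocals. *)
  - split; first by move: (past_zero _) (past_zero _) => [] [] /=; lia.
    case fp: (past_zero (x, y)); last by move=> /=; case: past_zero => /=; lia.
    case fq: (past_zero (x', y')); first by move=> /=; lia.
    move=> _; have [->|x0] := eqVneq x 0; [by left|right].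
    have [x'0 h] := nflag (negbT fq); split=> //.
    by apply: le_trans h; apply: flag.
  - move: y0 => /= y0.
    have -> : past_zero (x, y) = false by rewrite /past_zero/= y0 eqxx.
    split; first by case: past_zero => /=; lia.
    case fq: (past_zero (x', y')); first by move=> /=; lia.
    move=> _; right; have [x'0 h] := nflag (negbT fq).
    by rewrite p0// x'0 y0 mul0r.
  - rewrite addr0 /= => le.
    have fE : past_zero (x, y) = (x / y <= 0).
      by rewrite /past_zero/= y0 divr_le0E.
    have f'E : past_zero (x', y') = (x' / y' <= 0).
      by rewrite /past_zero/= y'0 divr_le0E.
    have iE : y / x = (x / y)^-1 by rewrite invf_div.
    have i'E : y' / x' = (x' / y')^-1 by rewrite invf_div.
    rewrite fE f'E; case: (lerP (x / y) 0) => h.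
      rewrite (le_trans le h); split=> // _.
      have [->|x0] := eqVneq x 0; [by left|right].
      have r0 : x / y < 0 by rewrite lt_neqAle h andbT mulf_neq0 ?invr_eq0.
      have r'0 := le_lt_trans le r0.
      have x'0 : x' != 0.
        by apply: contraTneq r'0 => ->; rewrite mul0r ltxx.
      by split=> //; rewrite iE i'E lef_nV2.
    case: (lerP (x' / y') 0) => h'.
      by split=> [|/addrI]; rewrite ?lerD2l.
    split=> // _; right.
    have x0 : x != 0 by apply: contraTneq h => ->; rewrite mul0r ltxx.
    have x'0 : x' != 0 by apply: contraTneq h' => ->; rewrite mul0r ltxx.
    by split=> //; rewrite iE i'E lef_pV2.
have [kf kfE] := key.
have [lt|le|eq] := ltgtP (k + (past_zero (x, y))%:Z + D)
                      (l + (past_zero (x', y'))%:Z + E); first by left.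
  by exfalso; lia.
right; split=> //=.
have DEe : D = E by lia.
case: kfE => [|->|[x0 x'0 h]]; [by lia|by left|right; split=> //].
by rewrite !frac//; have := ald DEe; lra.
Qed.

Lemma precedesW d k p l q : 0 <= d -> precedes d k p l q -> precedes 0 k p l q.
Proof.
move=> d0 [?|[-> [?|[? ? h]]]]; [by left|by right; split=> //; left|].
by right; split=> //; right; split=> //; lra.
Qed.

(** The induction carries only the order with gap 0. The gap [d n] is produced by the last step, so
    no lower bound on it has to survive the earlier ones. *)
Lemma solution_precedes a b (d : nat -> R) D E :
  (forall n, 0 <= d n) -> (forall n, D n <= E n) ->
  (forall n, D n = E n -> b n + d n <= a n) ->
  forall n, precedes (d n) (winding a D n.+1) (solution a n.+1)
                           (winding b E n.+1) (solution b n.+1).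
Proof.
move=> d0 DE dab n.
suff : precedes 0 (winding a D n) (solution a n) (winding b E n) (solution b n).
  exact: (precedes_step (@solution_neq0 _ _) (@solution_neq0 _ _) (DE n) (dab n)).
elim: n => [|n IHn]; first by right; split=> //; left.
apply: (@precedesW (d n)) => //.
exact: (precedes_step (@solution_neq0 _ _) (@solution_neq0 _ _) (DE n) (dab n)).
Qed.

(** Two flags differ by at most 1, which costs at most [n] over [n] steps. *)
Lemma winding_le (a b : nat -> R) D E : (forall n, D n <= E n) ->
  forall n, winding b E n - winding a D n <= \sum_(i < n) (E i - D i) + n%:Z.
Proof.
move=> DE; elim=> [|n IHn] /=; first by rewrite big_ord0.
rewrite big_ord_recr/=.
set S := \sum_(i < n) _ in IHn *.
move: (past_zero _) (past_zero _) => f f'.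
by case: f; case: f' => /=; rewrite -addn1 PoszD; lia.
Qed.

End Oscillation.

(** * Fekete's lemma and increments of the potential *)

Section Fekete.
Context {R : realType}.

(** Fekete's lemma: the limit is the infimum of a n / n over n > 0. Choose M almost realizing the
    infimum and divide n by M with remainder. *)
Lemma subadditive_cvg (a : nat -> R) : (forall n, 0 <= a n) ->
  (forall m n, a (m + n)%N <= a m + a n) ->
  cvgn (fun n => n%:R^-1 * a n).
Proof.
move=> a0 aD.
pose S := [set a n.+1 / n.+1%:R | n in [set: nat]].
have lbS : has_lbound S by exists 0 => _ [n _ <-]; rewrite divr_ge0.
have infS : has_inf S by split=> //; exists (a 1%N / 1%:R), 0%N.
apply/cvg_ex; exists (inf S); apply/cvgrPdist_le => e e0.
have e20 : 0 < e / 2 by lra.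
have [_ [m _ <-] hm] := inf_adherent e20 infS.
set M := m.+1 in hm.
have aM k r : a (k * M + r)%N <= k%:R * a M + a r.
  elim: k => [|k IH]; first by rewrite mul0n add0n mul0r add0r.
  by rewrite mulSn -addnA (le_trans (aD _ _))// -natr1 mulrDl; lra.
(* A bound for all possible remainder terms, independent of n; after division by n it becomes
   negligible. *)
pose B := \sum_(r < M) a r.
have aB r : (r < M)%N -> a r <= B.
  move=> rM; rewrite /B (bigD1 (Ordinal rM))//= lerDl; exact: sumr_ge0.
have B0 : 0 <= B by apply: sumr_ge0.
near=> n.
have n0 : (0 : R) < n%:R by rewrite ltr0n; near: n; exists 1%N.
have Sn : S (n%:R^-1 * a n).
  have nn : (0 < n)%N by rewrite -(ltr0n R).
  by exists n.-1; rewrite // prednK // mulrC.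
have lo : inf S <= n%:R^-1 * a n by exact: ge_inf.
rewrite distrC ger0_norm ?subr_ge0// lerBlDl.
have Bn : n%:R^-1 * B <= e / 2.
  rewrite ler_pdivrMl// -ler_pdivrMr//; near: n.
  exact: nbhs_infty_ger.
have M0 : (0 : R) < M%:R by rewrite ltr0n.
have q : (n %/ M)%:R * a M <= n%:R * (a M / M%:R).
  have qn : (n %/ M)%:R * M%:R <= n%:R :> R by rewrite -natrM ler_nat leq_divM.
  rewrite mulrA ler_pdivlMr// mulrAC; exact: ler_wpM2r.
have := aM (n %/ M)%N (n %% M)%N; rewrite -divn_eq => h.
have := aB (n %% M)%N; rewrite ltn_mod => /(_ isT) h2.
suff : n%:R^-1 * a n <= a M / M%:R + n%:R^-1 * B by lra.
rewrite ler_pdivrMl// mulrDr mulVKf ?gt_eqF//; lra.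
Unshelve. all: by end_near. Qed.

End Fekete.

Section Monotone.
Context {R : realType}.
Implicit Types v : R * R -> R.

Lemma within_continuousP {T : pseudoMetricType R} (A : set T) (f : T -> R) :
  {within A, continuous f} <->
  forall x, A x -> forall e : R, 0 < e ->
    exists2 d : R, 0 < d & forall y, A y -> ball x d y -> `|f y - f x| < e.
Proof.
rewrite subspace_continuousP; split=> cf x Ax.
  move=> e e0; move: (cf x Ax) => /cvgrPdist_lt /(_ e e0).
  rewrite near_withinE => /nbhs_ballP[d /= d0 H].
  by exists d => // y Ay xy; rewrite distrC; apply: H.
apply/cvgrPdist_lt => e e0; have [d d0 H] := cf x Ax e e0.
rewrite near_withinE; apply/nbhs_ballP; exists d => // y xy Ay.
by rewrite distrC; apply: H.
Qed.

Arguments within_continuousP {T A f}.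

(** The supremum of the points x with [G 0 <= G x] belongs to this set by continuity, and the local
    hypothesis moves it further right unless it is [h]. Only right neighbourhoods are involved,
    which suits points on the sides of the square. *)
Lemma increasing_right (G : R -> R) (h : R) : 0 <= h ->
  {within `[0, h], continuous G} ->
  (forall x : R, 0 <= x < h -> exists2 e : R, 0 < e & forall y : R, 0 < y < e -> x + y <= h ->
     G x <= G (x + y)) ->
  G 0 <= G h.
Proof.
move=> h0 cG step.
pose A := [set x | 0 <= x <= h /\ G 0 <= G x].
have A0 : A 0 by split=> //; rewrite lexx.
have hsA : has_sup A by split; [exists 0|exists h => x [/andP[]]].
set s := sup A.
have s0 : 0 <= s by apply: ub_le_sup => //; case: hsA.
have sh : s <= h by apply: ge_sup; [exists 0|move=> x [/andP[]]].
have Gs : G 0 <= G s.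
  rewrite leNgt; apply/negP => lt.
  have As : `[0, h]%classic s by rewrite /= in_itv/= s0.
  have gap : 0 < G 0 - G s by rewrite subr_gt0.
  have [e e0 He] := within_continuousP.1 cG s As _ gap.
  have [x [/andP[x0 xh] Gx] sx] := sup_adherent e0 hsA.
  have xs : x <= s by apply: ub_le_sup; [case: hsA|rewrite /A/= x0 xh].
  have xA : `[0, h]%classic x by rewrite /= in_itv/= x0.
  have bx : ball s e x by rewrite /ball/= ger0_norm ?subr_ge0// ltrBlDr -ltrBlDl.
  by have := He x xA bx; rewrite ltr_norml => /andP[_]; lra.
have [<-//|sh'] := eqVneq s h.
have {sh'}sh' : s < h by rewrite lt_neqAle sh'.
have [|e e0 He] := step s; first by rewrite s0.
pose y := Num.min (e / 2) (h - s).
have y0 : 0 < y by rewrite lt_min subr_gt0 sh' andbT; lra.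
have ye : y < e by rewrite gt_min; apply/orP; left; lra.
have yh : s + y <= h by rewrite -lerBrDl ge_min lexx orbT.
have : A (s + y).
  split; first by rewrite yh andbT; lra.
  by apply: (le_trans Gs); apply: He => //; rewrite y0.
by move=> /(ub_le_sup (proj2 hsA)); rewrite -/s; lra.
Qed.

Lemma derivable_within_is_derive (f : R -> R) (x : R) :
  0 < x < 1 -> derivable_within `[0, 1[ f x ->
  is_derive x 1 f (derive_within `[0, 1[ f x).
Proof.
move=> /andP[x0 x1] df.
have h : h^-1 *: (f (h *: 1 + x) - f x) @[h --> 0^'] --> derive_within `[0, 1[ f x.
  apply/cvgrPdist_lt => e e0; move/cvgrPdist_lt: df => /(_ e e0).
  rewrite near_withinE !near_withinE => /nbhs_ballP[d /= d0 H].
  apply/nbhs_ballP; exists (Num.min d (Num.min x (1 - x))) => /=.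
    by rewrite !lt_min d0 x0 subr_gt0.
  move=> y; rewrite /ball/= sub0r normrN !lt_min => /and3P[yd yx y1x] y0.
  have := H (y + x); rewrite /slope_at addrK /= mulrC in_itv/= [y *: 1]mulr1.
  apply.
  - by rewrite /ball/= opprD addrCA subrr addr0 normrN.
  - by rewrite -subr_eq0 addrK.
  - by move: yx y1x; rewrite !ltr_norml; lra.
split; first by apply/cvg_ex; eexists; exact: h.
exact/cvg_lim.
Qed.

(** The endpoint [a = 0] is allowed: the mean value theorem asks for differentiability only inside
    the interval, where the relative derivative is the usual one. *)
Lemma derive_within_MVT (f : R -> R) (a b : R) : 0 <= a -> a < b -> b < 1 ->
  (forall x, 0 <= x < 1 -> derivable_within `[0, 1[ f x) ->
  {within `[0, 1[, continuous f} ->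
  exists2 x, a < x < b & f b - f a = derive_within `[0, 1[ f x * (b - a).
Proof.
move=> a0 ab b1 df cf.
have [||x + xE] := @MVT R f (derive_within `[0, 1[ f) a b ab.
- move=> x; rewrite in_itv/= => /andP[ax xb].
  by apply: derivable_within_is_derive; [|apply: df]; lra.
- apply: continuous_subspaceW cf => x /=; rewrite !in_itv/=; lra.
by rewrite in_itv/= => xab; exists x.
Qed.

Lemma torusE (x y : R) : torus (x, y) <-> 0 <= x < 1 /\ 0 <= y < 1.
Proof. by rewrite /torus/= !in_itv. Qed.

(** By convexity the whole segment stays in the square. Along it, v minus the linear function of
    slope [c] increases locally to the right: a short move is split into a vertical and a horizontal
    one, with the mean value theorem on each and continuity of the partial derivatives. *)
Lemma C1_torus_increment v (p c : R) : C1_torus v -> 0 < p ->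
  (forall w, torus w -> c < dir_deriv (p, 1) v w) ->
  forall x y h : R, 0 <= h -> torus (x, y) -> torus (x + p * h, y + h) ->
  c * h <= v (x + p * h, y + h) - v (x, y).
Proof.
move=> [cv dv c1 c2] p0 vc x y h h0.
rewrite /torus/= !in_itv/= => -[/andP[x0 x1] /andP[y0 y1]] [/andP[_ xh] /andP[_ yh]].
pose G (s : R) := v (x + p * s, y + s) - c * s.
have inT (s : R) : 0 <= s <= h -> torus (x + p * s, y + s).
  move=> /andP[s0 sh]; have psh : p * s <= p * h by rewrite ler_pM2l.
  by have := mulr_ge0 (ltW p0) s0; rewrite torusE; lra.
suff : G 0 <= G h by rewrite /G !mulr0 !addr0; lra.
apply: increasing_right => //.
- apply/within_continuousP => s; rewrite /= in_itv/= => sh e e0.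
  have e20 : 0 < e / 2 by lra.
  have [d d0 H] := within_continuousP.1 cv _ (inT s sh) _ e20.
  have c0 : 0 < `|c| + 1 by have := normr_ge0 c; lra.
  have pp0 : 0 < p + 1 by lra.
  exists (Num.min (d / (p + 1)) (e / 2 / (`|c| + 1))).
    by rewrite lt_min !divr_gt0.
  move=> t; rewrite /= in_itv/= => th.
  rewrite /ball/= lt_min !ltr_pdivlMr// => /andP[t1 t2].
  have nd := normr_ge0 (s - t).
  have q1 : `|x + p * s - (x + p * t)| < d.
    have -> : x + p * s - (x + p * t) = p * (s - t) by ring.
    by rewrite normrM gtr0_norm//; nra.
  have q2 : `|y + s - (y + t)| < d.
    have -> : y + s - (y + t) = s - t by ring.
    by have := mulr_ge0 (ltW p0) nd; lra.
  have q3 : `|c * (s - t)| < e / 2.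
    by rewrite normrM; lra.
  have := H _ (inT t th) (conj q1 q2).
  by rewrite /G; move: q3; rewrite !ltr_norml; lra.
move=> s /andP[s0 sh].
have sh' : 0 <= s <= h by lra.
have := vc _ (inT s sh'); rewrite /dir_deriv/= mul1r => gap.
(* The excess of the directional derivative over [c], divided by [p + 1]: errors below [eta] in both
   partial derivatives cannot use up more than this excess. *)
pose eta := (p * partial1 v (x + p * s, y + s) + partial2 v (x + p * s, y + s) - c) / (p + 1).
have pp0 : 0 < p + 1 by lra.
have eta0 : 0 < eta by rewrite divr_gt0//; lra.
have [d1 d10 H1] := within_continuousP.1 c1 _ (inT s sh') _ eta0.
have [d2 d20 H2] := within_continuousP.1 c2 _ (inT s sh') _ eta0.
(* With this radius both t and p * t stay below d1 and d2. *)
exists (Num.min d1 d2 / (p + 1)); first by rewrite divr_gt0// lt_min d10.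
move=> t /andP[t0]; rewrite ltr_pdivlMr// lt_min => /andP[t1 t2] sth.
have pt0 : 0 < p * t by rewrite mulr_gt0.
have psh : p * (s + t) <= p * h by rewrite ler_pM2l.
have ps0 := mulr_ge0 (ltW p0) s0.
have pD : p * (s + t) = p * s + p * t by ring.
have sect1 b : 0 <= b < 1 -> {within `[0, 1[, continuous (fun a => v (a, b))}.
  move=> b01; apply/within_continuousP => a; rewrite /= in_itv/= => a01 e e0.
  have [d d0 H] := within_continuousP.1 cv (a, b) ((torusE _ _).2 (conj a01 b01)) e e0.
  exists d => // a'; rewrite /= in_itv/= => a'01 aa'.
  by apply: H; [apply/torusE|split=> //=; exact: ballxx].
have sect2 a : 0 <= a < 1 -> {within `[0, 1[, continuous (fun b => v (a, b))}.
  move=> a01; apply/within_continuousP => b; rewrite /= in_itv/= => b01 e e0.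
  have [d d0 H] := within_continuousP.1 cv (a, b) ((torusE _ _).2 (conj a01 b01)) e e0.
  exists d => // b'; rewrite /= in_itv/= => b'01 bb'.
  by apply: H; [apply/torusE|split=> //=; exact: ballxx].
(* The path turns at the corner (x + p * s, y + (s + t)): [xi] is on its horizontal part and [ze]
   below on its vertical part. *)
have [||||| xi xi1 xi2] := @derive_within_MVT (fun a => v (a, y + (s + t)))
    (x + p * s) (x + p * (s + t)); [lra..| | |].
- by move=> a a01; apply: (dv (a, y + (s + t)) _).1; apply/torusE; lra.
- by apply: sect1; lra.
have [||||| ze ze1 ze2] := @derive_within_MVT (fun b => v (x + p * s, b))
    (y + s) (y + (s + t)); [lra..| | |].
- by move=> b b01; apply: (dv (x + p * s, b) _).2; apply/torusE; lra.
- by apply: sect2; lra.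
have d1t : torus (xi, y + (s + t)) by apply/torusE; lra.
have d2t : torus (x + p * s, ze) by apply/torusE; lra.
have := H1 _ d1t; have := H2 _ d2t.
rewrite /partial1 /partial2 /=.
rewrite /partial1 /partial2 /= in gap eta0.
set D1 := derive_within _ _ xi in xi2 *; set D2 := derive_within _ _ ze in ze2 *.
set E1 := derive_within _ _ (x + p * s) in eta0 gap *.
set E2 := derive_within _ _ (y + s) in eta0 gap *.
move=> K2 K1.
have {}K1 : `|D1 - E1| < eta.
  by apply: K1; split; rewrite /= /ball/= ltr_norml; nra.
have {}K2 : `|D2 - E2| < eta.
  by apply: K2; split; rewrite /= /ball/= ltr_norml; nra.
have etaE : eta * (p + 1) = p * E1 + E2 - c by rewrite divfK ?gt_eqF.
have key : c <= p * D1 + D2.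
  by move: K1 K2; rewrite !ltr_norml; nra.
have e1 : x + p * (s + t) - (x + p * s) = p * t by ring.
have e2 : y + (s + t) - (y + s) = t by ring.
rewrite e1 in xi2; rewrite e2 in ze2.
have : c * t <= (p * D1 + D2) * t by rewrite ler_pM2r.
rewrite /G; lra.
Qed.
End Monotone.

(** * Measure preservation *)

Section Measure.
Context {R : realType}.
Local Notation mu := (@lebesgue_measure R).

Lemma measurable_mod1 (D : set R) : measurable_fun D (@mod1 R).
Proof.
apply: measurable_funTS.
apply: measurable_funB; first exact: measurable_id.
apply: (nondecreasing_measurable (D := setT)) => // x y xy.
by rewrite /= ler_int; apply: le_floor.
Qed.

Lemma mod1_itv (x : R) : 0 <= mod1 x < 1.
Proof. by rewrite /mod1; have /andP[] := floor_itv x; rewrite intrD; lra. Qed.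

Lemma mod1_id (x : R) : 0 <= x < 1 -> mod1 x = x :> R.
Proof. by move=> x01; rewrite /mod1 (@floor_def _ x 0) ?subr0// intrD add0r. Qed.

Lemma mod1Dint (x : R) (k : int) : mod1 (x + k%:~R) = mod1 x.
Proof. by rewrite /mod1 floorDrz ?intr_int// intrKfloor intrD; ring. Qed.

Lemma mod1Dmod1 (x y : R) : mod1 (x + mod1 y) = mod1 (x + y).
Proof. by rewrite {2}/mod1 -mulrNz addrA mod1Dint. Qed.

(** Translation preserves the length of half-open intervals, and these determine the measure. *)
Lemma lebesgue_measure_translate (a : R) (A : set R) : measurable A ->
  mu ((fun x => x + a) @^-1` A) = mu A.
Proof.
move=> mA.
pose f (x : measurableTypeR R) : measurableTypeR R := x + a.
have mf : measurable_fun setT f.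
  by apply: measurable_funD => //; exact: measurable_cst.
pose nu : {measure set (measurableTypeR R) -> \bar R} := pushforward mu f.
suff: forall X, ocitv X -> mu X = nu mf X.
  by move=> /(@lebesgue_measure_unique R (nu mf)) /(_ A mA) ->.
move=> _ [[u w]] _ <- /=.
rewrite /nu /pushforward.
have -> : (fun x : R => x + a) @^-1` `]u, w]%classic = `]u - a, w - a]%classic.
  by apply/seteqP; split=> x /=; rewrite !in_itv/=; lra.
rewrite !lebesgue_measure_itv/= !lte_fin ltrBlDr subrK.
by case: ifP => // _; rewrite -!EFinB; congr EFin; ring.
Qed.

(** A rotation by b in [0, 1) cuts [0, 1) at 1 - b and translates the two pieces by b and by b -
    1. *)
Lemma lebesgue_measure_rotate (a : R) (A : set R) : measurable A ->
  mu (`[0, 1[ `&` (fun x => mod1 (x + a)) @^-1` A) = mu (`[0, 1[ `&` A).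
Proof.
move=> mA; set b := mod1 a; have /andP[b0 b1] : 0 <= b < 1 := mod1_itv a.
have modb x : mod1 (x + a) = mod1 (x + b).
  by rewrite mod1Dmod1.
have mI u w : measurable (`[u, w[ `&` A : set R) by exact: measurableI.
have mT u w d : measurable ((fun x : R => x + d) @^-1` (`[u, w[ `&` A)).
  rewrite -[X in measurable X]setTI; apply: measurable_funD => //; exact: measurable_cst.
have -> : `[0, 1[ `&` (fun x => mod1 (x + a)) @^-1` A =
    (fun x => x + b) @^-1` (`[b, 1[ `&` A) `|`
    (fun x => x + (b - 1)) @^-1` (`[0, b[ `&` A).
  have m1 x : 0 <= x -> x < 1 - b -> mod1 (x + a) = x + b.
    by move=> *; rewrite modb mod1_id//; lra.
  have m2 x : 1 - b <= x -> x < 1 -> mod1 (x + a) = x + (b - 1).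
    move=> *; rewrite modb -(mod1Dint _ (-1)) mod1_id; rewrite mulrN1z; lra.
  apply/seteqP; split=> x /=; rewrite !in_itv/=.
    move=> [/andP[x0 x1]]; have [xb|xb] := ltP x (1 - b).
      by rewrite m1// => Ax; left; split=> //; lra.
    by rewrite m2// => Ax; right; split=> //; lra.
  move=> [] [/andP[h1 h2] Ax]; split; try lra.
    by rewrite m1//; lra.
  by rewrite m2//; lra.
have -> : `[0, 1[ `&` A = (`[b, 1[ `&` A) `|` (`[0, b[ `&` A).
  rewrite -setIUl setUC; congr (_ `&` _).
  apply/seteqP; split=> x /=; rewrite !in_itv/=; last by case; lra.
  by move=> x01; case: (ltP x b) => xb; [left|right]; lra.
rewrite (measureU mu (mT b 1 b) (mT 0 b (b - 1))); last first.
  by apply/seteqP; split=> x //= -[]; rewrite !in_itv/=; lra.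
rewrite (measureU mu (mI b 1) (mI 0 b)); last first.
  by apply/seteqP; split=> x //= -[]; rewrite !in_itv/=; lra.
by congr (_ + _)%E; apply: lebesgue_measure_translate.
Qed.

(* [R] and [measurableTypeR R] carry the same measurable sets under different
   displays; the product measure lives on the latter. *)
Local Notation plane := (measurableTypeR R * measurableTypeR R)%type.

Lemma lebesgue2_xsection (A : set plane) : measurable A ->
  lebesgue2 A = (\int[mu]_x mu (xsection A x))%E.
Proof. by []. Qed.

Lemma lebesgue2_ysection (A : set plane) : measurable A ->
  lebesgue2 A = (\int[mu]_y mu (ysection A y))%E.
Proof.
move=> mA; rewrite lebesgue2_xsection//.
have := indic_fubini_tonelli mu mu mA.
by rewrite indic_fubini_tonelli_FE// indic_fubini_tonelli_GE.
Qed.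

(** The maps live on the whole plane, hence the explicit intersections with [torus]. *)
Definition preserves_torus (T : plane -> plane) :=
  [/\ measurable_fun setT T, forall w, torus w -> torus (T w) &
      forall A, measurable A ->
        lebesgue2 (torus `&` T @^-1` A) = lebesgue2 (torus `&` A)].

Lemma measurable_torus : measurable (torus : set plane).
Proof. exact: measurableX. Qed.

Lemma preserves_torus_comp S T : preserves_torus S -> preserves_torus T ->
  preserves_torus (S \o T).
Proof.
move=> [mS tS S_] [mT tT T_]; split; first exact: measurableT_comp.
  by move=> w /tT/tS.
move=> A mA; rewrite comp_preimage T_ ?S_//.
by rewrite -[X in measurable X]setTI; exact: mS.
Qed.

(** Each horizontal section is rotated, by an amount depending on its height, and Tonelli's theorem
    integrates over the heights. Heights outside [0, 1) give empty sections. *)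
Lemma preserves_torus_shear1 (h : R -> R) : measurable_fun setT h ->
  preserves_torus (fun w : plane => (mod1 (w.1 + h w.2), w.2)).
Proof.
move=> mh; set S := fun w => _.
have mS : measurable_fun setT S.
  apply/measurable_fun_pairP; split => /=; last exact: measurable_snd.
  apply: (measurableT_comp (@measurable_mod1 setT)).
  by apply: measurable_funD => //; apply: measurableT_comp.
split=> //.
  by move=> [x y] /torusE[x01 y01]; apply/torusE; split=> //; exact: mod1_itv.
move=> A mA.
have mSA : measurable (S @^-1` A) by rewrite -[X in measurable X]setTI; exact: mS.
rewrite !lebesgue2_ysection; try by apply: measurableI => //; exact: measurable_torus.
apply: eq_integral => y _.
have [y01|y01] := boolP (0 <= y < 1).
  transitivity (mu (`[0, 1[ `&` (fun x => mod1 (x + h y)) @^-1` ysection A y)).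
    congr (mu _); apply/seteqP; split=> x; rewrite /ysection /= inE/=.
      by move=> [/torusE[x01 _] SA]; rewrite in_itv/= inE.
    by move=> [x01]; rewrite inE => SA; split => //; apply/torusE; move: x01; rewrite in_itv.
  rewrite lebesgue_measure_rotate; last exact: measurable_ysection.
  congr (mu _); apply/seteqP; split=> x; rewrite /ysection /= in_itv/= !inE/=.
    by move=> [x01 xA]; split => //; apply/torusE.
  by move=> [/torusE[x01 _] xA].
congr (mu _); apply/seteqP; split=> x; rewrite /ysection /= !inE/=.
  by move=> [/torusE[_ yy]]; rewrite yy in y01.
by move=> [/torusE[_ yy]]; rewrite yy in y01.
Qed.

Lemma preserves_torus_shear2 (h : R -> R) : measurable_fun setT h ->
  preserves_torus (fun w : plane => (w.1, mod1 (w.2 + h w.1))).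
Proof.
move=> mh; set S := fun w => _.
have mS : measurable_fun setT S.
  apply/measurable_fun_pairP; split => /=; first exact: measurable_fst.
  apply: (measurableT_comp (@measurable_mod1 setT)).
  by apply: measurable_funD => //; apply: measurableT_comp.
split=> //.
  by move=> [x y] /torusE[x01 y01]; apply/torusE; split=> //; exact: mod1_itv.
move=> A mA.
have mSA : measurable (S @^-1` A) by rewrite -[X in measurable X]setTI; exact: mS.
rewrite !lebesgue2_xsection; try by apply: measurableI => //; exact: measurable_torus.
apply: eq_integral => x _.
have [x01|x01] := boolP (0 <= x < 1).
  transitivity (mu (`[0, 1[ `&` (fun y => mod1 (y + h x)) @^-1` xsection A x)).
    congr (mu _); apply/seteqP; split=> y; rewrite /xsection /= inE/=.
      by move=> [/torusE[_ y01] SA]; rewrite in_itv/= inE.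
    by move=> [y01]; rewrite inE => SA; split => //; apply/torusE; move: y01; rewrite in_itv.
  rewrite lebesgue_measure_rotate; last exact: measurable_xsection.
  congr (mu _); apply/seteqP; split=> y; rewrite /xsection /= in_itv/= !inE/=.
    by move=> [y01 xA]; split => //; apply/torusE.
  by move=> [/torusE[_ y01] xA].
congr (mu _); apply/seteqP; split=> y; rewrite /xsection /= !inE/=.
  by move=> [/torusE[xx _]]; rewrite xx in x01.
by move=> [/torusE[xx _]]; rewrite xx in x01.
Qed.

(** The matrix is a product of two shears: (2 1; 1 1) = (1 1; 0 1) (1 0; 1 1). *)
Lemma preserves_torus_cat_map : preserves_torus (@cat_map R).
Proof.
have -> : @cat_map R = (fun w => (mod1 (w.1 + w.2), w.2)) \o
                       (fun w => (w.1, mod1 (w.2 + w.1))).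
  apply/funext => -[x y] /=; congr pair; last by rewrite addrC.
  by rewrite /cat_map /= mod1Dmod1; congr mod1; ring.
have mid : measurable_fun setT (fun x : R => x) := @measurable_id _ _ _.
exact: (preserves_torus_comp (preserves_torus_shear1 mid)
                             (preserves_torus_shear2 mid)).
Qed.

Lemma preserves_torus_iter T n : preserves_torus T -> preserves_torus (iter n T).
Proof.
move=> pT; elim: n => [|n IH]; first by split=> //; exact: measurable_id.
exact: (preserves_torus_comp pT IH).
Qed.

Lemma integral_preserves_torus T (f : plane -> \bar R) : preserves_torus T ->
  measurable_fun torus f -> (forall w, torus w -> 0 <= f w)%E ->
  (\int[lebesgue2]_(w in torus) f (T w) = \int[lebesgue2]_(w in torus) f w)%E.
Proof.
move=> [mT tT pT] mf f0.
(* Sending the complement of the torus to a point outside of the torus makes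
   the torus its own preimage. *)
pose S (w : plane) : plane := if w \in torus then T w else (2, 2) : plane.
have torS : S @^-1` torus = torus.
  apply/seteqP; split=> w; rewrite /= /S.
    by case: ifPn => [/set_mem//|_ /torusE]; lra.
  by move=> tw; rewrite mem_set//; exact: tT.
have mS : measurable_fun (setT : set plane) S.
  apply: measurable_fun_ifT => //.
  apply: (measurable_fun_bool true).
  rewrite [X in measurable X](_ : _ = torus); first exact: measurable_torus.
  by apply/seteqP; split=> w /=; [move=> [_ /set_mem]|split=> //; exact: mem_set].
have ST w : torus w -> S w = T w by move=> tw; rewrite /S mem_set.
clearbody S.
have mt := measurable_torus.
have := ge0_integral_pushforward mS (@lebesgue2 R) mt mf.
rewrite torS => /(_ (fun w tw => f0 w (set_mem tw))) /esym fS.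
transitivity (\int[lebesgue2]_(w in torus) (f \o S) w)%E.
  by apply: eq_integral => w tw /=; rewrite (ST _ (set_mem tw)).
have SA A : measurable A -> A `<=` torus -> lebesgue2 (S @^-1` A) = lebesgue2 A.
  move=> mA At; have := pT A mA; rewrite (setIidr At) => <-; congr (lebesgue2 _).
  apply/seteqP; split=> w /= => [Aw|[tw]]; last by rewrite (ST _ tw); exact.
  have tw : torus w by rewrite -torS; exact: At.
  by split; [exact: tw|rewrite -(ST _ tw); exact: Aw].
rewrite fS; apply: eq_measure_integral => A mA At.
exact: SA.
Qed.

End Measure.

(** * Operator norm of 2x2 matrices *)

Section OperatorNorm.
Context {R : realType}.
Implicit Types (A B : 'M[R]_2) (x : 'cV[R]_2).

Lemma euclid_norm2 x : euclid_norm x = Num.sqrt (x 0 0 ^+ 2 + x 1 0 ^+ 2).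
Proof.
rewrite /euclid_norm big_ord_recl big_ord1; congr (Num.sqrt (_ + _ ^+ 2)).
by congr (x _ _); apply/val_inj.
Qed.

Lemma mulmx2E n A (B : 'M[R]_(2, n)) i j :
  (A *m B) i j = A i 0 * B 0 j + A i 1 * B 1 j.
Proof.
rewrite mxE big_ord_recl big_ord1; congr (_ + _ * _);
  by congr fun_of_matrix; apply/val_inj.
Qed.

Definition frobenius2 A : R := A 0 0 ^+ 2 + A 1 0 ^+ 2 + A 0 1 ^+ 2 + A 1 1 ^+ 2.

Lemma euclid_norm_ge0 x : 0 <= euclid_norm x.
Proof. exact: sqrtr_ge0. Qed.

Lemma euclid_norm_mulmx_frobenius A x :
  euclid_norm (A *m x) <= Num.sqrt (frobenius2 A) * euclid_norm x.
Proof.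
rewrite !euclid_norm2 !mulmx2E -sqrtrM; last by rewrite /frobenius2 !addr_ge0// sqr_ge0.
apply: ler_wsqrtr; rewrite /frobenius2 -subr_ge0.
set a := A 0 0; set b := A 0 1; set c := A 1 0; set d := A 1 1.
set u := x 0 0; set w := x 1 0.
(* Lagrange's identity for the two rows, which gives the Cauchy-Schwarz inequality. *)
have -> : (a ^+ 2 + c ^+ 2 + b ^+ 2 + d ^+ 2) * (u ^+ 2 + w ^+ 2) -
  ((a * u + b * w) ^+ 2 + (c * u + d * w) ^+ 2) =
  (a * w - b * u) ^+ 2 + (c * w - d * u) ^+ 2 by ring.
by rewrite addr_ge0// sqr_ge0.
Qed.

Lemma euclid_normZ (k : R) x : euclid_norm (k *: x) = `|k| * euclid_norm x.
Proof.
by rewrite !euclid_norm2 !mxE !exprMn -mulrDr sqrtrM ?sqr_ge0// sqrtr_sqr.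
Qed.

Lemma euclid_norm_eq0 x : euclid_norm x = 0 -> x = 0.
Proof.
move=> /eqP; rewrite euclid_norm2 sqrtr_eq0 => h.
have [h0 h1] : x 0 0 = 0 /\ x 1 0 = 0.
  have := sqr_ge0 (x 0 0); have := sqr_ge0 (x 1 0) => ? ?.
  by split; apply/eqP; rewrite -sqrf_eq0; apply/eqP; lra.
apply/matrixP => i j; rewrite mxE ord1; case: (unliftP 0 i) => [k ->|->//].
by rewrite ord1 -h1; congr (x _ _); apply/val_inj.
Qed.

Definition col2 (u w : R) : 'cV[R]_2 := \col_i if i == 0 then u else w.

Lemma euclid_norm_col2 u w : euclid_norm (col2 u w) = Num.sqrt (u ^+ 2 + w ^+ 2).
Proof. by rewrite euclid_norm2 !mxE. Qed.

Let ball_img A := [set euclid_norm (A *m x) | x in [set x : 'cV[R]_2 | euclid_norm x = 1]].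

Let has_sup_img A : has_sup (ball_img A).
Proof.
split.
  exists (euclid_norm (A *m col2 1 0)), (col2 1 0) => //=.
  by rewrite euclid_norm_col2 expr1n expr0n addr0 sqrtr1.
exists (Num.sqrt (frobenius2 A)) => _ [x /= x1 <-].
by have := euclid_norm_mulmx_frobenius A x; rewrite x1 mulr1.
Qed.

Lemma op_norm_le A (M : R) :
  (forall x, euclid_norm x = 1 -> euclid_norm (A *m x) <= M) -> op_norm A <= M.
Proof.
move=> AM; apply: ge_sup; first by case: (has_sup_img A).
by move=> _ [x x1 <-]; exact: AM.
Qed.

Lemma op_norm_ge0 A : 0 <= op_norm A.
Proof.
have [[_ [x x1 _]] ub] := has_sup_img A.
by apply: (le_trans (euclid_norm_ge0 (A *m x))); apply: ub_le_sup => //; exists x.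
Qed.

Lemma euclid_norm_mulmx A x : euclid_norm (A *m x) <= op_norm A * euclid_norm x.
Proof.
have [/eqP n0|n0] := boolP (euclid_norm x == 0).
  by rewrite (euclid_norm_eq0 n0) mulmx0 -(scale0r (0 : 'cV_2)) euclid_normZ normr0 !mul0r mulr0.
have xp : 0 < euclid_norm x by rewrite lt_neqAle eq_sym n0 euclid_norm_ge0.
rewrite -ler_pdivrMr// mulrC.
rewrite -[X in X * _](@ger0_norm _ (euclid_norm x)^-1) ?invr_ge0 ?euclid_norm_ge0//.
rewrite -euclid_normZ scalemxAr; apply: ub_le_sup; first by case: (has_sup_img A).
exists ((euclid_norm x)^-1 *: x) => //=.
by rewrite euclid_normZ ger0_norm ?invr_ge0 ?ltW// mulVf.
Qed.

Lemma op_normM A B : op_norm (A *m B) <= op_norm A * op_norm B.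
Proof.
apply: op_norm_le => x x1; rewrite -mulmxA.
apply: (le_trans (euclid_norm_mulmx _ _)); apply: ler_wpM2l; first exact: op_norm_ge0.
by have := euclid_norm_mulmx B x; rewrite x1 mulr1.
Qed.

Lemma op_norm_entry A : `|A 0 0| <= op_norm A.
Proof.
have := euclid_norm_mulmx A (col2 1 0).
rewrite euclid_norm_col2 expr1n expr0n addr0 sqrtr1 mulr1; apply: le_trans.
rewrite euclid_norm2 !mulmx2E !mxE /= !mulr1 !mulr0 !addr0 -sqrtr_sqr.
by apply: ler_wsqrtr; rewrite lerDl sqr_ge0.
Qed.

Lemma op_norm_frobenius A : op_norm A <= Num.sqrt (frobenius2 A).
Proof.
apply: op_norm_le => x x1.
by have := euclid_norm_mulmx_frobenius A x; rewrite x1 mulr1.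
Qed.

(* The singular values s, 1/s of a matrix of determinant 1 satisfy
   (s +- 1/s)^2 = frobenius2 A +- 2. *)
Lemma op_norm_SL2 A : A 0 0 * A 1 1 - A 0 1 * A 1 0 = 1 ->
  op_norm A = (Num.sqrt (frobenius2 A + 2) + Num.sqrt (frobenius2 A - 2)) / 2.
Proof.
rewrite /frobenius2.
set a := A 0 0; set b := A 0 1; set c := A 1 0; set d := A 1 1 => det1.
(* [p], [q], [r] are the entries of the symmetric matrix A^T A, and [h] is its trace. *)
set h := _ + _ + _ + _; pose p := a ^+ 2 + c ^+ 2; pose r := b ^+ 2 + d ^+ 2.
pose q := a * b + c * d.
have hpr : h = p + r by rewrite /h /p /r; ring.
have hp : h + 2 = (a + d) ^+ 2 + (b - c) ^+ 2.
  by rewrite /h; lra.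
have hm : h - 2 = (a - d) ^+ 2 + (b + c) ^+ 2.
  by rewrite /h; lra.
have hp0 : 0 <= h + 2 by rewrite hp addr_ge0// sqr_ge0.
have hm0 : 0 <= h - 2 by rewrite hm addr_ge0// sqr_ge0.
set s1 := Num.sqrt (h + 2); set s2 := Num.sqrt (h - 2); set s := _ / 2.
have s10 : 0 <= s1 := sqrtr_ge0 _.
have s20 : 0 <= s2 := sqrtr_ge0 _.
have s0 : 0 <= s by rewrite divr_ge0// addr_ge0.
have s1E : s1 ^+ 2 = h + 2 := sqr_sqrtr hp0.
have s2E : s2 ^+ 2 = h - 2 := sqr_sqrtr hm0.
(* [D] is the difference s^2 - s^-2 of the eigenvalues of A^T A, so that s^2 = (h + D) / 2. *)
pose D := s1 * s2; have D0 : 0 <= D by exact: mulr_ge0.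
have sE : s ^+ 2 = (h + D) / 2.
  have -> : s ^+ 2 = (s1 ^+ 2 + s2 ^+ 2 + 2 * D) / 4 by rewrite /s /D; field.
  by rewrite s1E s2E; field.
have DE : D ^+ 2 = (p - r) ^+ 2 + 4 * q ^+ 2.
  have -> : D ^+ 2 = (h + 2) * (h - 2) by rewrite -s1E -s2E /D; ring.
  have -> : (h + 2) * (h - 2) = h ^+ 2 - 4 * (a * d - b * c) ^+ 2.
    by rewrite det1; ring.
  by rewrite hpr /p /q /r; ring.
have normE x : euclid_norm (A *m x) ^+ 2 =
    p * x 0 0 ^+ 2 + 2 * q * x 0 0 * x 1 0 + r * x 1 0 ^+ 2.
  rewrite euclid_norm2 sqr_sqrtr ?addr_ge0 ?sqr_ge0// !mulmx2E -/a -/b -/c -/d /p /q /r.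
  by ring.
apply/eqP; rewrite eq_le; apply/andP; split.
  apply: op_norm_le => x x1.
  rewrite -(@ler_pXn2r _ 2) ?nnegrE ?euclid_norm_ge0// normE sE.
  have xx : x 0 0 ^+ 2 + x 1 0 ^+ 2 = 1.
    by rewrite -[RHS](expr1n _ 2) -x1 euclid_norm2 sqr_sqrtr// addr_ge0 ?sqr_ge0.
  set u := x 0 0 in xx *; set w := x 1 0 in xx *.
  have key : (p - r) * (u ^+ 2 - w ^+ 2) + 4 * q * u * w <= D.
    apply: le_trans (ler_norm _) _; rewrite -(@ler_pXn2r _ 2) ?nnegrE//.
    rewrite real_normK ?num_real// DE -subr_ge0.
    (* Cauchy-Schwarz for (p - r, 2 q) and (u^2 - w^2, 2 u w); the latter is a unit vector, as in
       the double angle formulas. *)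
    have -> : (p - r) ^+ 2 + 4 * q ^+ 2 - ((p - r) * (u ^+ 2 - w ^+ 2) + 4 * q * u * w) ^+ 2
      = ((p - r) ^+ 2 + 4 * q ^+ 2) * (1 - (u ^+ 2 + w ^+ 2) ^+ 2) +
        (2 * (p - r) * u * w - 2 * q * (u ^+ 2 - w ^+ 2)) ^+ 2 by ring.
    by rewrite xx expr1n subrr mulr0 add0r sqr_ge0.
  have u2 : u ^+ 2 = 1 - w ^+ 2 by lra.
  by rewrite hpr; move: key; rewrite u2; lra.
have test x : 0 < euclid_norm x ->
    euclid_norm (A *m x) ^+ 2 = s ^+ 2 * euclid_norm x ^+ 2 -> s <= op_norm A.
  move=> x0 /eqP; rewrite -exprMn eqrXn2 ?euclid_norm_ge0
    ?(mulr_ge0 s0 (euclid_norm_ge0 x))// => /eqP Ax.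
  by rewrite -(ler_pM2r x0) -Ax euclid_norm_mulmx.
have dD : 0 <= D + (p - r).
  suff : - (p - r) <= D by lra.
  apply: le_trans (ler_norm _) _; rewrite -(@ler_pXn2r _ 2) ?nnegrE//.
  by rewrite normrN real_normK ?num_real// DE; have := sqr_ge0 q; lra.
(* The vector (D + (p - r), 2 q) is an eigenvector of A^T A for s^2 unless it vanishes; in the case
   [E0] the second basis vector is one. *)
have [E0|E0] := eqVneq (D + (p - r)) 0.
  apply: (test (col2 0 1)).
    by rewrite euclid_norm_col2 expr0n expr1n /= add0r sqrtr1 ltr01.
  rewrite normE euclid_norm_col2 sqr_sqrtr ?addr_ge0 ?sqr_ge0// !mxE /= sE hpr.
  have -> : D = r - p by lra.
  by field.
have E1 : 0 < D + (p - r) by rewrite lt_neqAle eq_sym E0.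
have nn : 0 < (D + (p - r)) ^+ 2 + (2 * q) ^+ 2.
  by apply: (lt_le_trans (y := (D + (p - r)) ^+ 2)); [rewrite exprn_gt0|rewrite lerDl sqr_ge0].
apply: (test (col2 (D + (p - r)) (2 * q))).
  by rewrite euclid_norm_col2 sqrtr_gt0.
rewrite normE euclid_norm_col2 (sqr_sqrtr (ltW nn)) !mxE /= sE hpr.
have q2 : 4 * q ^+ 2 = D ^+ 2 - (p - r) ^+ 2 by rewrite DE; ring.
have -> : p * (D + (p - r)) ^+ 2 + 2 * q * (D + (p - r)) * (2 * q) + r * (2 * q) ^+ 2 =
   p * (D + (p - r)) ^+ 2 + (4 * q ^+ 2) * (D + (p - r) + r) by ring.
have -> : (2 * q) ^+ 2 = 4 * q ^+ 2 by ring.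
by rewrite q2; field.
Qed.

(** This makes all logarithms of norms nonnegative, so that their integrals can be handled as
    integrals of nonnegative functions. *)
Lemma op_norm_SL2_ge1 A : A 0 0 * A 1 1 - A 0 1 * A 1 0 = 1 -> 1 <= op_norm A.
Proof.
move=> det1; rewrite op_norm_SL2//.
have hm : frobenius2 A - 2 = (A 0 0 - A 1 1) ^+ 2 + (A 0 1 + A 1 0) ^+ 2.
  by rewrite /frobenius2; lra.
have h2 : 4 <= frobenius2 A + 2.
  by have := sqr_ge0 (A 0 0 - A 1 1); have := sqr_ge0 (A 0 1 + A 1 0); lra.
have : 2 <= Num.sqrt (frobenius2 A + 2).
  rewrite -[leLHS](ger0_norm (ler0n R 2)) -sqrtr_sqr.
  by apply: ler_wsqrtr; lra.
by have := sqrtr_ge0 (frobenius2 A - 2); lra.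
Qed.

End OperatorNorm.

(** * Unstable segments *)

Section UnstableLine.
Context {R : realType}.

Definition golden : R := (1 + Num.sqrt 5) / 2.

Lemma golden_sqr : golden ^+ 2 = golden + 1.
Proof.
have h : Num.sqrt 5 ^+ 2 = 5 :> R by rewrite sqr_sqrtr.
have -> : golden ^+ 2 = (1 + 2 * Num.sqrt 5 + Num.sqrt 5 ^+ 2) / 4.
  by rewrite /golden; field.
by rewrite h /golden; field.
Qed.

Lemma golden_itv : 1 < golden < 2.
Proof.
have h : Num.sqrt 5 ^+ 2 = 5 :> R by rewrite sqr_sqrtr.
have h0 : 0 <= Num.sqrt 5 :> R := sqrtr_ge0 _.
by rewrite /golden; nra.
Qed.

Definition cat_linear (w : R * R) : R * R := (2 * w.1 + w.2, w.1 + w.2).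

Definition project (w : R * R) : R * R := (mod1 w.1, mod1 w.2).

Lemma cat_map_project w : cat_map (project w) = project (cat_linear w).
Proof.
have mE x : mod1 x = x + (- Num.floor x)%:~R :> R by rewrite /mod1 mulrNz.
rewrite /cat_map /project /cat_linear /=; congr pair.
  have -> : 2 * mod1 w.1 + mod1 w.2 =
      2 * w.1 + w.2 + (- Num.floor w.1 - Num.floor w.1 - Num.floor w.2)%:~R.
    by rewrite !mE !intrD; ring.
  by rewrite mod1Dint.
by rewrite mod1Dmod1 addrC mod1Dmod1 addrC.
Qed.

Lemma iter_cat_map_project n w :
  iter n cat_map (project w) = project (iter n cat_linear w).
Proof. by elim: n => //= n ->; rewrite cat_map_project. Qed.

(** The vector ([golden], 1) is an eigenvector of the linear lift with eigenvalue [golden ^+ 2]. *)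
Lemma iter_cat_linear_unstable n (x y h : R) :
  iter n cat_linear (x + golden * h, y + h) =
  ((iter n cat_linear (x, y)).1 + golden * ((golden ^+ 2) ^+ n * h),
   (iter n cat_linear (x, y)).2 + (golden ^+ 2) ^+ n * h).
Proof.
elim: n => [|n IHn]; first by rewrite !expr0 !mul1r.
rewrite [LHS]iterS IHn iterS /cat_linear /= (exprS (golden ^+ 2)).
set q := (golden ^+ 2) ^+ n.
(* The quadratic relation is multiplied in advance by the two factors that occur, so that the goal
   becomes linear in the monomials. *)
have /(congr1 ( *%R^~ (q * h))) /= gg : golden * golden = golden + 1.
  by rewrite -expr2 golden_sqr.
have /(congr1 ( *%R^~ (q * h * golden))) /= ggg : golden * golden = golden + 1.
  by rewrite -expr2 golden_sqr.
by rewrite expr2; congr pair; lra.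
Qed.

(** Coordinates adapted to the unstable direction: the first one labels a segment, the second is the
    parameter along it. *)
Definition unstable_shear (w : R * R) : R * R := (mod1 (w.1 + golden * w.2), w.2).

(** Sum of the coordinates of the integer cell that contains the n-th image in the lift. Both
    coordinates increase with [t], so equal values at two parameters mean the same cell. *)
Definition crossings (s t : R) (n : nat) : int :=
  let z := iter n cat_linear (s + golden * t, t) in
  Num.floor z.1 + Num.floor z.2.

Lemma iter_cat_map_unstable_shear n (s t : R) : 0 <= t < 1 ->
  iter n cat_map (unstable_shear (s, t)) =
  project (iter n cat_linear (s + golden * t, t)).
Proof.
move=> t01; rewrite -iter_cat_map_project; congr iter.
by rewrite /unstable_shear /project /= (mod1_id t01).
Qed.

Lemma unstable_split n (s t t' : R) :
  iter n cat_linear (s + golden * t', t') =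
  ((iter n cat_linear (s + golden * t, t)).1 + golden * ((golden ^+ 2) ^+ n * (t' - t)),
   (iter n cat_linear (s + golden * t, t)).2 + (golden ^+ 2) ^+ n * (t' - t)).
Proof.
rewrite -iter_cat_linear_unstable; congr (iter _ _ (_, _)); ring.
Qed.

Let rho0 n : 0 < (golden ^+ 2) ^+ n.
Proof. by rewrite !exprn_gt0//; have := golden_itv; lra. Qed.

Lemma crossings_le (s t t' : R) n : t <= t' -> crossings s t n <= crossings s t' n.
Proof.
move=> tt'; rewrite /crossings (unstable_split n s t t') /=.
have h : 0 <= (golden ^+ 2) ^+ n * (t' - t).
  by apply: mulr_ge0; [exact: ltW (rho0 n)|rewrite subr_ge0].
have g := golden_itv.
by apply: lerD; apply: le_floor; rewrite lerDl// mulr_ge0//; lra.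
Qed.

(** The displacements of the two coordinates are at most 2 q and q, because [golden < 2]; the two
    floors add at most 2. *)
Lemma crossings_growth (s t t' : R) n : 0 <= t -> t <= t' -> t' <= 1 ->
  (crossings s t' n - crossings s t n)%:~R <= 3 * (golden ^+ 2) ^+ n + 2 :> R.
Proof.
move=> t0 tt' t1; rewrite /crossings (unstable_split n s t t') /=.
set z := iter _ _ _; set q := (golden ^+ 2) ^+ n; have q0 : 0 < q := rho0 n.
have g := golden_itv.
have fl (x : R) : (Num.floor x)%:~R <= x < (Num.floor x)%:~R + 1.
  by have := floor_itv x; rewrite intrD.
have := fl z.1; have := fl z.2.
have := fl (z.1 + golden * (q * (t' - t))); have := fl (z.2 + q * (t' - t)).
rewrite !intrD !mulrNz.
have h1 : q * (t' - t) <= q by rewrite ger_pMr//; lra.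
have h0 : 0 <= q * (t' - t) by apply: mulr_ge0; [exact: ltW (rho0 n)|rewrite subr_ge0].
have h2 : golden * (q * (t' - t)) <= 2 * q by nra.
by rewrite !intrD; lra.
Qed.

Lemma potential_decreasing v (c lam E : R) : C1_torus v ->
  (forall w, torus w -> c < dir_deriv unstable_dir v w) -> 0 < lam ->
  forall (s t t' : R) n, 0 <= t -> t <= t' -> t' < 1 ->
  crossings s t n = crossings s t' n ->
  E - lam * v (iter n cat_map (unstable_shear (s, t'))) +
    lam * c * (golden ^+ 2) ^+ n * (t' - t) <=
  E - lam * v (iter n cat_map (unstable_shear (s, t))).
Proof.
move=> vC1 vc lam0 s t t' n t0 tt' t1 cr.
rewrite !iter_cat_map_unstable_shear; [|lra|lra].
move: cr; rewrite /crossings (unstable_split n s t t') /=.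
set z := iter _ _ _; set q := (golden ^+ 2) ^+ n.
set h := q * (t' - t).
have h0 : 0 <= h by apply: mulr_ge0; [exact: ltW (rho0 n)|rewrite subr_ge0].
have g := golden_itv; have g0 : 0 < golden by lra.
have gh0 := mulr_ge0 (ltW g0) h0.
have f1 : Num.floor z.1 <= Num.floor (z.1 + golden * h) by apply: le_floor; lra.
have f2 : Num.floor z.2 <= Num.floor (z.2 + h) by apply: le_floor; lra.
move=> cr.
(* Each floor is monotone, so equality of the sums forces equality of both. *)
have e1 : Num.floor (z.1 + golden * h) = Num.floor z.1 by lia.
have e2 : Num.floor (z.2 + h) = Num.floor z.2 by lia.
have pE : project (z.1 + golden * h, z.2 + h) =
    ((project z).1 + golden * h, (project z).2 + h).
  by rewrite /project /mod1 /= e1 e2; congr pair; ring.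
have pt w : torus (project w).
  by apply/torusE; split; exact: mod1_itv.
have := @C1_torus_increment _ v golden c vC1 g0 vc (project z).1 (project z).2 h h0.
rewrite -pE -surjective_pairing => /(_ (pt _) (pt _)).
by move=> /(ler_wpM2l (ltW lam0)); rewrite /h; lra.
Qed.

(** Write rho for [golden ^+ 2]. A step adds at most 3 rho^(n+1) + 3, and 9 rho^n + 3 rho^(n+1) + 3
    <= 9 rho^(n+1) because rho > 2. *)
Lemma crossings_sum (s t t' : R) n : 0 <= t -> t <= t' -> t' <= 1 ->
  (\sum_(i < n.+1) (crossings s t' i - crossings s t i) + n.+1%:Z)%:~R <=
  9 * (golden ^+ 2) ^+ n :> R.
Proof.
move=> t0 tt' t1; have g := golden_itv; have g2 := golden_sqr.
elim: n => [|n IHn].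
  rewrite big_ord1 intrD.
  by have := crossings_growth s 0 t0 tt' t1; rewrite expr0; lra.
have gr := crossings_growth s n.+1 t0 tt' t1.
rewrite big_ord_recr /= -[n.+2]addn1 PoszD addrACA.
rewrite !intrD in IHn gr *; rewrite (exprS (golden ^+ 2)) in gr *.
have : 1 <= (golden ^+ 2) ^+ n by rewrite exprn_ege1// golden_sqr; lra.
set q := (golden ^+ 2) ^+ n in gr IHn * => q1.
by rewrite g2 in gr *; nra.
Qed.

End UnstableLine.

(** * Measure of the set of small ratios *)

Lemma absz_subr_inj (x y z : int) :
  `|(y - x)%R|%N = `|(z - x)%R|%N -> x <= y -> x <= z -> y = z.
Proof. by lia. Qed.

Section SmallDivisors.
Context {R : realType}.
Local Notation mu := (@lebesgue_measure R).
Local Notation plane := (measurableTypeR R * measurableTypeR R)%type.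

(** Each class of [K] lies in the interval of radius [d] around any of its points, whence 2 d for
    each of the [N] classes. *)
Lemma lebesgue_measure_le_classes (A : set R) (K : R -> nat) (N : nat) (d : R) :
  measurable A -> 0 <= d -> (forall t, A t -> (K t < N)%N) ->
  (forall t t', A t -> A t' -> t < t' -> K t = K t' -> t' - t <= d) ->
  (mu A <= (N%:R * (2 * d))%:E)%E.
Proof.
move=> mA d0 KN Kd.
have /choice[F FP] : forall k, exists F : set R, [/\ measurable F,
    (mu F <= (2 * d)%:E)%E & forall t, A t -> K t = k -> F t].
  move=> k; have [[t0 [At0 Kt0]]|no] := pselect (exists t, A t /\ K t = k).
    exists `[t0 - d, t0 + d]%classic; split.
    - exact: measurable_itv.
    - rewrite lebesgue_measure_itv /= lte_fin; case: ifP => // _.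
        by rewrite -EFinB lee_fin; lra.
      by rewrite lee_fin; lra.
    - move=> t At Kt; rewrite /= in_itv /=.
      have [lt|gt|->] := ltgtP t t0.
      + by have := Kd _ _ At At0 lt (etrans Kt (esym Kt0)); lra.
      + by have := Kd _ _ At0 At gt (etrans Kt0 (esym Kt)); lra.
      + by lra.
  exists set0; split; [exact: measurable0|by rewrite measure0 lee_fin; lra|].
  by move=> t At Kt; case: no; exists t.
have mF k : measurable (F k) by case: (FP k).
have AF : A `<=` \big[setU/set0]_(k < N) F k.
  move=> t At; rewrite -bigcup_mkord; exists (K t); first exact: KN.
  by have [_ _] := FP (K t); apply.
have := @content_subadditive _ _ _ mu A F N (fun k _ => mF k) mA AF.
move=> /le_trans; apply.
apply: (@le_trans _ _ (\sum_(k < N) (2 * d)%:E)%E).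
  by apply: lee_sum => k _; case: (FP k).
by rewrite sumEFin lee_fin sumr_const card_ord -[leLHS]mulr_natl.
Qed.

Lemma lebesgue2_le_xsection (B : set plane) (C : R) : measurable B -> 0 <= C ->
  (forall s, 0 <= s < 1 -> (mu (xsection B s) <= C%:E)%E) -> B `<=` torus ->
  (lebesgue2 B <= C%:E)%E.
Proof.
move=> mB C0 BC Bt.
have mI : measurable (`[0, 1[%classic : set (measurableTypeR R)) by exact: measurable_itv.
rewrite lebesgue2_xsection//.
apply: (@le_trans _ _ (\int[mu]_s (C * \1_(`[0, 1[%classic : set R) s)%:E)%E).
  apply: ge0_le_integral => //.
  - exact: measurable_fun_xsection.
  - by apply/measurable_EFinP; apply: measurable_funM => //; exact: measurable_indic.
  move=> s _; have [s01|s01] := boolP (0 <= s < 1).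
    by rewrite indicE mem_set /= ?in_itv //= mulr1 BC.
  have -> : xsection B s = set0.
    rewrite -subset0 => t; rewrite /xsection /= inE => /Bt /torusE[s01' _].
    by rewrite s01' in s01.
  by rewrite measure0 lee_fin mulr_ge0.
under eq_integral do rewrite EFinM.
rewrite ge0_integralZl//; last first.
  by apply/measurable_EFinP; exact: measurable_indic.
rewrite integral_indic// setIT.
have mu01 : mu (`[0, 1[%classic : set R) = 1%:E.
  by rewrite lebesgue_measure_itv /= lte_fin ltr01 -EFinB subr0.
by rewrite [X in (_ * X)%E](mu01 : _ = 1%:E) mule1.
Qed.

Definition column (v : R * R -> R) (lam E : R) (w : R * R) : nat -> R * R :=
  solution (fun i => E - lam * v (iter i cat_map w)).

(** The bound on the ratio is multiplied out, so that zeros of psi_n need no separate treatment. *)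
Definition small_ratio v lam E n (d : R) : set plane :=
  [set w | torus w /\ `|(column v lam E w n.+1).1| <= d * `|(column v lam E w n).1|].

Lemma preserves_torus_unstable_shear : preserves_torus (@unstable_shear R).
Proof.
apply: (@preserves_torus_shear1 _ (fun t => golden * t)).
by apply: measurable_funM => //; exact: measurable_cst.
Qed.

(** With q = [golden ^+ 2] to the power [n], the counter takes at most 10 q values on the segment,
    and each value is attained in the set on a part of diameter at most 2 d / (lam c q). Covering by
    intervals of twice that length gives 40 = 10 * 2 * 2, and q cancels. *)
Lemma small_ratio_slice v (c lam E : R) n d s : C1_torus v -> 0 < c ->
  (forall w, torus w -> c < dir_deriv unstable_dir v w) -> 0 < lam -> 0 <= d ->
  forall A : set R, measurable A ->
  (forall t, A t -> 0 <= t < 1 /\ small_ratio v lam E n d (unstable_shear (s, t))) ->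
  (mu A <= (40 * d / (lam * c))%:E)%E.
Proof.
move=> vC1 c0 vc lam0 d0 A mA AS.
pose q := (golden ^+ 2) ^+ n : R.
have q1 : 1 <= q.
  by have g := @golden_itv R; rewrite exprn_ege1// golden_sqr; lra.
pose a t i := E - lam * v (iter i cat_map (unstable_shear (s, t))).
pose k i := lam * c * (golden ^+ 2) ^+ i.
have kn : k n = lam * c * q by [].
have lc0 : 0 < lam * c by rewrite mulr_gt0.
have kn0 : 0 < k n by rewrite kn mulr_gt0//; lra.
pose W t := winding (a t) (crossings s t) n.+1.
have WP t t' : 0 <= t -> t < t' -> t' < 1 ->
    precedes (k n * (t' - t)) (W t) (solution (a t) n.+1)
                              (W t') (solution (a t') n.+1).
  move=> t0 tt' t1.
  apply: (@solution_precedes _ _ _ (fun i => k i * (t' - t))).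
  - move=> i; rewrite mulr_ge0 ?subr_ge0 ?(ltW tt')// /k mulr_ge0 ?(ltW lc0)//.
    by have g := @golden_itv R; rewrite !exprn_ge0//; lra.
  - by move=> i; apply: crossings_le; exact: ltW.
  - move=> i cr; exact: (potential_decreasing E vC1 vc lam0 t0 (ltW tt') t1 cr).
(* The counter is least at t = 0, so its excess over [W 0] can label the classes by natural
   numbers. *)
have W0 t : 0 <= t < 1 -> W 0 <= W t.
  move=> /andP[]; rewrite le_eqVlt => /predU1P[<-//|t0 t1].
  by have [/ltW//|[-> _]] := WP 0 t (lexx _) t0 t1.
have W1 t : 0 <= t < 1 -> (W t - W 0)%:~R <= 9 * q :> R.
  move=> /andP[t0 t1].
  have := @crossings_sum R s 0 t n (lexx _) t0 (ltW t1); apply: le_trans.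
  by rewrite ler_int; apply: winding_le => i; exact: crossings_le.
pose N := (Num.trunc (9 * q)).+1.
have NE : (9 * q) < N%:R /\ N%:R <= 10 * q.
  have /andP[h1 h2] : (Num.trunc (9 * q))%:R <= 9 * q < N%:R.
    by apply: truncn_itv; lra.
  by split=> //; rewrite /N -natr1; lra.
pose K (t : R) := `|(W t - W 0)%R|%N.
have [KN1 KN2] := NE.
apply: (@le_trans _ _ (N%:R * (2 * (2 * d / k n)))%:E).
  apply: (@lebesgue_measure_le_classes _ K) => //.
  - by apply: divr_ge0; [exact: mulr_ge0|exact: ltW].
  - move=> t /AS[t01 _]; rewrite -(ltr_nat R) /K natr_absz.
    by rewrite ger0_norm ?subr_ge0 ?W0//; apply: le_lt_trans KN1; exact: W1.
  move=> t t' /AS[t01 [_ +]] /AS[t'01 [_ +]] tt' Ktt'.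
  rewrite -/(a t) -/(a t') => r r'.
  have WW : W t = W t'.
    exact: (absz_subr_inj Ktt' (W0 t t01) (W0 t' t'01)).
  (* The second entry of a solution is by definition the first entry one step earlier. *)
  have {}r : `|(solution (a t) n.+1).1| <= d * `|(solution (a t) n.+1).2| := r.
  have {}r' : `|(solution (a t') n.+1).1| <= d * `|(solution (a t') n.+1).2| := r'.
  have := WP t t'; move: t01 t'01 => /andP[t0 _] /andP[_ t1] /(_ t0 tt' t1).
  case=> [|[_ [y0|[y0 y'0]]]]; first by rewrite WW ltxx.
    (* An infinite ratio is excluded: the small ratio bound would make both entries vanish. *)
    have := solution_neq0 y0; move: r; rewrite y0 normr0 mulr0.
    by rewrite normr_le0 => ->.
  have ratio (x y : R) : y != 0 -> `|x| <= d * `|y| -> `|x / y| <= d.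
    by move=> yn0; rewrite normrM normfV ler_pdivrMr ?normr_gt0.
  move: (ratio _ _ y0 r) (ratio _ _ y'0 r').
  (* Both ratios lie in [-d, d] and are k n * (t' - t) apart. *)
  rewrite !ler_norml => b1 b2 b3.
  by rewrite ler_pdivlMr// mulrC; lra.
rewrite lee_fin.
have -> : N%:R * (2 * (2 * d / k n)) = N%:R / q * (4 * d / (lam * c)).
  by rewrite kn; field; rewrite !gt_eqF//; lra.
have -> : 40 * d / (lam * c) = 10 * (4 * d / (lam * c)) by ring.
apply: ler_wpM2r; first by apply: divr_ge0; [exact: mulr_ge0|exact: ltW].
by rewrite ler_pdivrMr//; lra.
Qed.

(** The measure preserving shear straightens the unstable segments into vertical fibres, where the
    bound on slices applies. *)
Lemma lebesgue2_small_ratio v (c lam E : R) n d : C1_torus v -> 0 < c ->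
  (forall w, torus w -> c < dir_deriv unstable_dir v w) -> 0 < lam -> 0 <= d ->
  measurable (small_ratio v lam E n d) ->
  (lebesgue2 (small_ratio v lam E n d) <= (40 * d / (lam * c))%:E)%E.
Proof.
move=> vC1 c0 vc lam0 d0 mB; set B := small_ratio _ _ _ _ _ in mB *.
have [mS tS pS] := preserves_torus_unstable_shear.
have Bt : B `<=` torus by move=> w [].
have := pS B mB; rewrite (setIidr Bt) => <-.
have mSB : measurable (torus `&` @unstable_shear R @^-1` B : set plane).
  apply: measurableI; first exact: measurable_torus.
  by rewrite -[X in measurable X]setTI; exact: mS.
apply: lebesgue2_le_xsection => //.
  by apply: divr_ge0; [exact: mulr_ge0|exact: ltW (mulr_gt0 lam0 c0)].
move=> s s01; apply: (small_ratio_slice (s := s) (E := E) (n := n) vC1 c0 vc lam0 d0).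
  exact: measurable_xsection.
move=> t; rewrite /xsection /= inE /= => -[/torusE[_ t01] Bw].
by split; [exact: t01|exact: Bw].
Qed.

End SmallDivisors.

(** * The Lyapunov exponent *)

Section Cocycle.
Context {R : realType}.
Local Notation plane := (measurableTypeR R * measurableTypeR R)%type.
Implicit Types (v : R * R -> R) (lam E : R) (w : R * R).

Lemma cocycle_row0 v lam E n w j : cocycle v lam E n.+1 w 0 j =
  (E - lam * v (iter n cat_map w)) * cocycle v lam E n w 0 j
  - cocycle v lam E n w 1 j.
Proof. by rewrite [LHS]mulmx2E !mxE /= mulN1r. Qed.

Lemma cocycle_row1 v lam E n w j :
  cocycle v lam E n.+1 w 1 j = cocycle v lam E n w 0 j.
Proof. by rewrite [LHS]mulmx2E !mxE /= mul0r mul1r addr0. Qed.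

Lemma cocycle_column v lam E n w :
  (cocycle v lam E n w 0 0, cocycle v lam E n w 1 0) = column v lam E w n.
Proof.
elim: n => [|n IHn]; first by rewrite /= !mxE.
by rewrite cocycle_row0 cocycle_row1 /column /= -/(column v lam E w n) -IHn.
Qed.

Lemma cocycle_det v lam E n w :
  cocycle v lam E n w 0 0 * cocycle v lam E n w 1 1
  - cocycle v lam E n w 0 1 * cocycle v lam E n w 1 0 = 1.
Proof.
elim: n => [|n IHn]; first by rewrite /= !mxE /=; ring.
by rewrite !cocycle_row0 !cocycle_row1 -[RHS]IHn; ring.
Qed.

Lemma cocycleD v lam E m n w : cocycle v lam E (m + n) w =
  cocycle v lam E m (iter n cat_map w) *m cocycle v lam E n w.
Proof.
elim: m => [|m IHm]; first by rewrite /= mul1mx.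
by rewrite addSn /= IHm iterD mulmxA.
Qed.

Lemma torus_iter_cat_map n w : torus w -> torus (iter n cat_map w).
Proof. by have [_ h _] := preserves_torus_iter n (@preserves_torus_cat_map R); exact: h. Qed.

Lemma measurable_cocycle v lam E n i j : measurable_fun (torus : set plane) v ->
  measurable_fun (torus : set plane) (fun w : plane => cocycle v lam E n w i j : R).
Proof.
move=> mv.
have ord2 (k : 'I_2) : k = 0 \/ k = 1.
  by case: k => [[|[|k]] hk] //; [left|right]; apply/val_inj.
elim: n i => [|n IHn] i; first exact: measurable_cst.
have mvn : measurable_fun (torus : set plane)
    (fun w : plane => v (iter n cat_map w) : R).
  have [mT tT _] := preserves_torus_iter n (@preserves_torus_cat_map R).
  apply: (measurable_comp (F := torus : set plane)).
  - exact: measurable_torus.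
  - by move=> _ [w tw <-]; exact: tT.
  - exact: mv.
  - exact: measurable_funTS mT.
case: (ord2 i) => ->.
  under eq_fun do rewrite cocycle_row0.
  apply: measurable_funB; last exact: IHn.
  apply: measurable_funM; last exact: IHn.
  apply: measurable_funB; first exact: measurable_cst.
  by apply: measurable_funM => //; exact: measurable_cst.
under eq_fun do rewrite cocycle_row1.
exact: IHn.
Qed.

Lemma op_norm_cocycle_ge1 v lam E n w : 1 <= op_norm (cocycle v lam E n w).
Proof. by apply: op_norm_SL2_ge1; exact: cocycle_det. Qed.

Lemma measurable_sqrt : measurable_fun setT (@Num.sqrt R).
Proof. by apply: continuous_measurable_fun; exact: sqrt_continuous. Qed.

(** The norm is a supremum over an uncountable set; the closed formula for determinant 1 expresses
    it by the entries, which are measurable. *)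
Lemma measurable_ln_op_norm v lam E n : measurable_fun (torus : set plane) v ->
  measurable_fun (torus : set plane)
    (fun w : plane => ln (op_norm (cocycle v lam E n w)) : R).
Proof.
move=> mv; apply: (measurableT_comp (@measurable_ln R)).
under eq_fun do rewrite (op_norm_SL2 (cocycle_det _ _ _ _ _)).
have mA i j := measurable_cocycle lam E n i j mv.
have mh : measurable_fun (torus : set plane)
    (fun w : plane => frobenius2 (cocycle v lam E n w) : R).
  rewrite /frobenius2.
  by repeat apply: measurable_funD; apply: measurable_funX; exact: mA.
apply: measurable_funM; last exact: measurable_cst.
apply: measurable_funD; apply: (measurableT_comp measurable_sqrt).
  by apply: measurable_funD => //; exact: measurable_cst.
by apply: measurable_funB => //; exact: measurable_cst.
Qed.

Lemma ln_op_norm_cocycleD v lam E m n w :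
  ln (op_norm (cocycle v lam E (m + n) w)) <=
  ln (op_norm (cocycle v lam E m (iter n cat_map w))) +
  ln (op_norm (cocycle v lam E n w)).
Proof.
have pos k w' : op_norm (cocycle v lam E k w') \is Num.pos.
  by rewrite posrE; apply: lt_le_trans (op_norm_cocycle_ge1 _ _ _ _ _).
rewrite -lnM// ler_ln//; first by rewrite cocycleD; exact: op_normM.
by rewrite rpredM.
Qed.

(** Boundedness of v enters here, to make the integrals of the logarithms finite. *)
Lemma ln_op_norm_cocycle_le v lam E : (exists M, forall w, torus w -> `|v w| <= M) ->
  exists2 L, 0 <= L & forall n w, torus w ->
    ln (op_norm (cocycle v lam E n w)) <= n%:R * L.
Proof.
move=> [M vM].
have pos k w' : op_norm (cocycle v lam E k w') \is Num.pos.
  by rewrite posrE; apply: lt_le_trans (op_norm_cocycle_ge1 _ _ _ _ _).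
(* A bound for the squared Frobenius norm of one step; the 2 comes from the entries -1 and 1. *)
pose S := (`|E| + `|lam| * M) ^+ 2 + 2.
have S0 : 1 <= S by have := sqr_ge0 (`|E| + `|lam| * M); rewrite /S; lra.
have S1 : 1 <= Num.sqrt S by rewrite -[leLHS]sqrtr1; exact: ler_wsqrtr.
exists (ln (Num.sqrt S)); first exact: ln_ge0.
have step w : torus w -> ln (op_norm (cocycle v lam E 1 w)) <= ln (Num.sqrt S).
  move=> tw; rewrite ler_ln//; last by rewrite posrE; lra.
  apply: le_trans (op_norm_frobenius _) _; apply: ler_wsqrtr.
  rewrite /frobenius2 !cocycle_row0 !cocycle_row1 !mxE /= /S.
  have : `|E - lam * v w| <= `|E| + `|lam| * M.
    apply: le_trans (ler_normB _ _) _; rewrite lerD2l normrM.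
    by apply: ler_wpM2l => //; exact: vM.
  move=> h; have : `|E - lam * v w| ^+ 2 <= (`|E| + `|lam| * M) ^+ 2.
    by rewrite ler_pXn2r ?nnegrE//; apply: le_trans h.
  by rewrite real_normK ?num_real//; lra.
elim=> [|n IHn] w tw.
  rewrite mul0r -[leRHS]ln1 ler_ln ?posrE ?ltr01//; last by rewrite -posrE.
  by apply: op_norm_le => x x1; rewrite /= mul1mx x1.
have := ln_op_norm_cocycleD v lam E 1 n w; rewrite add1n => /le_trans; apply.
rewrite -natr1 mulrDl mul1r addrC.
exact: lerD (IHn w tw) (step _ (torus_iter_cat_map n tw)).
Qed.

Lemma measurable_small_ratio v lam E n d : measurable_fun (torus : set plane) v ->
  measurable (small_ratio v lam E n d).
Proof.
move=> mv.
have colE k w : (column v lam E w k).1 = cocycle v lam E k w 0 0.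
  by rewrite -cocycle_column.
have mx k : measurable_fun (torus : set plane)
    (fun w : plane => `|(column v lam E w k).1| : R).
  under eq_fun do rewrite colE.
  by apply: measurableT_comp => //; exact: measurable_cocycle.
have := measurable_fun_ler (mx n.+1) (measurable_funM (measurable_cst d) (mx n)).
by move=> /(_ measurable_torus [set true] I).
Qed.

End Cocycle.

(** * Logarithmic defect of a step *)

Section Lyapunov.
Context {R : realType}.
Local Notation plane := (measurableTypeR R * measurableTypeR R)%type.
Implicit Types (v : R * R -> R) (lam E : R) (w : R * R).

Lemma lebesgue2_torus : lebesgue2 (torus : set plane) = 1%:E.
Proof.
have m01 : lebesgue_measure (`[0, 1[%classic : set R) = 1%:E.
  by rewrite lebesgue_measure_itv /= lte_fin ltr01 -EFinB subr0.
have mI : measurable (`[0, 1[%classic : set (measurableTypeR R)).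
  exact: measurable_itv.
apply: etrans (product_measure1E (@lebesgue_measure R) (@lebesgue_measure R) mI mI) _.
exact: (etrans (congr2 mule m01 m01) (mule1 _)).
Qed.

(* Layer-cake form of the negative part of the logarithm of
   |psi_(n+1)| / (lam |psi_n|), infinite where psi_(n+1) vanishes. *)
Definition log_defect v lam E n w : \bar R :=
  (\sum_(0 <= k <oo)
     (ln 2 * \1_(small_ratio v lam E n (lam * 2^-1 ^+ k)) w : R)%:E)%E.

Let ln2_gt0 : 0 < ln 2 :> R.
Proof. by rewrite ln_gt0// ltr1n. Qed.

Let term_ge0 v lam E n k w :
  (0 <= (ln 2 * \1_(small_ratio v lam E n (lam * 2^-1 ^+ k)) w : R)%:E)%E.
Proof. by rewrite lee_fin mulr_ge0// ltW. Qed.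

Lemma log_defect_ge0 v lam E n w : (0 <= log_defect v lam E n w)%E.
Proof. by apply: nneseries_ge0. Qed.

Lemma log_defect_ge v lam E n w (N : nat) :
  (forall k, (k < N)%N -> small_ratio v lam E n (lam * 2^-1 ^+ k) w) ->
  ((N%:R * ln 2)%:E <= log_defect v lam E n w)%E.
Proof.
move=> H; apply: le_trans (nneseries_lim_ge N _); last by [].
rewrite big_mkord (eq_bigr (fun=> (ln 2)%:E)) => [|k _]; last first.
  by rewrite indicE mem_set ?mulr1//; exact: H.
by rewrite sumEFin sumr_const card_ord mulr_natl.
Qed.

Lemma log_defect_infty v lam E n w : 0 < lam -> torus w ->
  (column v lam E w n.+1).1 = 0 -> log_defect v lam E n w = +oo%E.
Proof.
move=> lam0 tw x0; apply: eq_infty => r.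
pose N := (Num.trunc (`|r| / ln 2)).+1.
have h : `|r| / ln 2 < N%:R by rewrite truncnS_gt.
apply: (@le_trans _ _ (N%:R * ln 2)%:E).
  rewrite lee_fin; apply: le_trans (ler_norm _) _.
  by rewrite -ler_pdivrMr//; exact: ltW.
apply: log_defect_ge => k _; split; first exact: tw.
by rewrite x0 normr0 !mulr_ge0// ?exprn_ge0 ?invr_ge0// ltW.
Qed.

(** With r the left side, the point belongs to the k-th set as soon as k ln 2 <= r. Counting k = 0
    too, there are more than r / ln 2 such indices, each contributing ln 2. *)
Lemma log_defect_step v lam E n w : 0 < lam -> torus w ->
  (column v lam E w n).1 != 0 -> (column v lam E w n.+1).1 != 0 ->
  ((ln lam + ln `|(column v lam E w n).1| - ln `|(column v lam E w n.+1).1|)%:E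
    <= log_defect v lam E n w)%E.
Proof.
move=> lam0 tw; set x := (column v lam E w n).1; set y := (column v lam E w n.+1).1.
rewrite -!normr_gt0 => x0 y0.
set r := ln lam + _ - _.
have [r0|r0] := ltP r 0.
  by apply: le_trans (log_defect_ge0 _ _ _ _ _); rewrite lee_fin ltW.
pose N := (Num.trunc (r / ln 2)).+1.
have r20 : 0 <= r / ln 2 by rewrite divr_ge0// ltW.
have h : r / ln 2 < N%:R by rewrite truncnS_gt.
apply: (@le_trans _ _ (N%:R * ln 2)%:E).
  by rewrite lee_fin -ler_pdivrMr//; exact: ltW.
apply: log_defect_ge => k; rewrite ltnS => kN; split; first exact: tw.
have kr : k%:R * ln 2 <= r.
  rewrite -ler_pdivlMr//; apply: le_trans (_ : (Num.trunc (r / ln 2))%:R <= _).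
    by rewrite ler_nat.
  by have /andP[] := truncn_itv r20.
rewrite -/x -/y.
have p0 : 0 < 2^-1 ^+ k :> R by rewrite exprn_gt0// invr_gt0.
rewrite -ler_ln ?posrE ?mulr_gt0//.
rewrite lnM ?posrE ?mulr_gt0// lnM ?posrE// lnXn ?invr_gt0//.
rewrite lnV ?posrE// mulNrn -[ln 2 *+ k]mulr_natl.
by move: kr; rewrite /r; lra.
Qed.

(** The one-step bounds telescope from psi_0 = 1, and |psi_n| is at most the norm. *)
Lemma log_defect_sum v lam E n w : 0 < lam -> torus w ->
  ((n%:R * ln lam)%:E <= (ln (op_norm (cocycle v lam E n w)))%:E
     + \sum_(i < n) log_defect v lam E i w)%E.
Proof.
move=> lam0 tw.
pose S k := (\sum_(i < k) log_defect v lam E i w)%E.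
have S0 k : (0 <= S k)%E by apply: sume_ge0 => i _; exact: log_defect_ge0.
(* Once some psi_i vanishes the sum of defects is infinite and remains so; otherwise the logarithms
   are genuine. *)
suff : S n = +oo%E \/ (column v lam E w n).1 != 0 /\
    ((n%:R * ln lam)%:E <= (ln `|(column v lam E w n).1|)%:E + S n)%E.
  rewrite -/(S n) => -[->|[x0 h]]; first by rewrite addey// leey.
  apply: le_trans h _; apply: leeD => //; rewrite lee_fin.
  have := op_norm_entry (cocycle v lam E n w).
  have -> : cocycle v lam E n w 0 0 = (column v lam E w n).1.
    by rewrite -cocycle_column.
  move=> h; rewrite ler_ln// posrE ?normr_gt0//.
  by apply: lt_le_trans h; rewrite normr_gt0.
elim: n => [|n IHn].
  right; split; first by rewrite /= oner_eq0.
  by rewrite mul0r /= normr1 ln1 /S big_ord0 adde0.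
have SS : S n.+1 = (S n + log_defect v lam E n w)%E by rewrite /S big_ord_recr.
case: IHn => [Sn|[x0 h]].
  by left; rewrite SS Sn addye// gt_eqF// (lt_le_trans _ (log_defect_ge0 _ _ _ _ _)).
have [y0|y0] := eqVneq (column v lam E w n.+1).1 0.
  left; rewrite SS log_defect_infty// addey// gt_eqF//.
  by rewrite (lt_le_trans _ (S0 n)).
right; split=> //; rewrite SS.
have g := log_defect_step lam0 tw x0 y0.
apply: le_trans (_ : ((ln `|(column v lam E w n.+1).1|)%:E + (((n%:R * ln lam) -
   ln `|(column v lam E w n).1|)%:E + (ln lam + ln `|(column v lam E w n).1|
   - ln `|(column v lam E w n.+1).1|)%:E) <= _)%E).
  by rewrite -!EFinD lee_fin -natr1; lra.
apply: leeD => //; apply: leeD => //.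
by rewrite EFinB leeBlDl.
Qed.

(** For d = lam 2^-k the measure bound is 40 * 2^-k / c, free of lam; the geometric series sums to
    2, hence 80. *)
Lemma integral_log_defect v (c lam E : R) n : C1_torus v ->
  measurable_fun (torus : set plane) v -> 0 < c ->
  (forall w, torus w -> c < dir_deriv unstable_dir v w) -> 0 < lam ->
  (\int[lebesgue2]_(w in torus) log_defect v lam E n w <= (80 * ln 2 / c)%:E)%E.
Proof.
move=> vC1 mv c0 vc lam0.
have mB k := measurable_small_ratio lam E n (lam * 2^-1 ^+ k) mv.
have mt := @measurable_torus R.
have mf k : measurable_fun (torus : set plane) (fun w : plane =>
    (\1_(small_ratio v lam E n (lam * 2^-1 ^+ k)) w)%:E : \bar R).
  by apply/measurable_EFinP; exact: measurable_indic.
rewrite integral_nneseries//; last first.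
  move=> k; under eq_fun do rewrite EFinM.
  by apply: emeasurable_funM => //; exact: measurable_cst.
have term k : (\int[lebesgue2]_(w in (torus : set plane))
    (ln 2 * \1_(small_ratio v lam E n (lam * 2^-1 ^+ k)) w : R)%:E <=
    (40 * ln 2 / c * 2^-1 ^+ k)%:E)%E.
  under eq_integral do rewrite EFinM.
  rewrite ge0_integralZl//; last by rewrite lee_fin ltW.
  rewrite integral_indic//.
  have -> : small_ratio v lam E n (lam * 2^-1 ^+ k) `&` torus =
            small_ratio v lam E n (lam * 2^-1 ^+ k) by apply: setIidl => w [].
  have d0 : 0 <= lam * 2^-1 ^+ k by rewrite mulr_ge0 ?exprn_ge0 ?invr_ge0// ltW.
  have := lebesgue2_small_ratio (E := E) (n := n) vC1 c0 vc lam0 d0 (mB k).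
  have l20 : (0 <= (ln 2 : R)%:E)%E by rewrite lee_fin ltW.
  move=> /(lee_wpmul2l l20) /le_trans; apply.
  rewrite -EFinM lee_fin le_eqVlt; apply/orP; left; apply/eqP.
  by field; rewrite !gt_eqF.
apply: lime_le.
  by apply: is_cvg_nneseries => k _ _; apply: integral_ge0.
near=> N; rewrite big_mkord.
apply: (@le_trans _ _ (\sum_(k < N) (40 * ln 2 / c * 2^-1 ^+ k)%:E)%E).
  by apply: lee_sum => k _; exact: term.
rewrite sumEFin lee_fin -mulr_sumr.
have geo : \sum_(k < N) 2^-1 ^+ k = 2 - 2 * 2^-1 ^+ N :> R.
  elim: (N) => [|m IH]; first by rewrite big_ord0 expr0; ring.
  by rewrite big_ord_recr /= IH exprS; field.
rewrite geo.
have : 0 <= 40 * ln 2 / c :> R by rewrite divr_ge0 ?mulr_ge0// ltW.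
have : 0 <= 2^-1 ^+ N :> R by rewrite exprn_ge0// invr_ge0.
set q := 2^-1 ^+ N; set t := 40 * _ / _ => q0 t0.
have -> : 80 * ln 2 / c = 2 * t by rewrite /t; field; rewrite gt_eqF.
by nra.
Unshelve. all: by end_near. Qed.

End Lyapunov.

(** * Averages of the logarithm and their lower bound *)

Section Limit.
Context {R : realType}.
Local Notation plane := (measurableTypeR R * measurableTypeR R)%type.
Implicit Types (v : R * R -> R) (lam E : R) (w : R * R).

Definition log_average v lam E n : R :=
  Rintegral lebesgue2 (torus : set plane)
    (fun w : plane => ln (op_norm (cocycle v lam E n w))).

Let ln_op_norm_ge0 v lam E n w : (0 <= (ln (op_norm (cocycle v lam E n w)))%:E)%E.
Proof. by rewrite lee_fin ln_ge0// op_norm_cocycle_ge1. Qed.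

Lemma log_averageE v lam E n : measurable_fun (torus : set plane) v ->
  (exists M, forall w, torus w -> `|v w| <= M) ->
  (log_average v lam E n)%:E =
  (\int[lebesgue2]_(w in (torus : set plane))
     (ln (op_norm (cocycle v lam E n w)))%:E)%E.
Proof.
move=> mv vM; rewrite /log_average /Rintegral fineK//.
have [L L0 fL] := ln_op_norm_cocycle_le lam E vM.
have mt := @measurable_torus R.
have mf := measurable_ln_op_norm lam E n mv.
rewrite ge0_fin_numE; last by apply: integral_ge0.
apply: (@le_lt_trans _ _ (\int[lebesgue2]_(w in (torus : set plane)) (n%:R * L)%:E)%E).
  apply: ge0_le_integral => //; first exact/measurable_EFinP.
  by move=> w tw; rewrite lee_fin; exact: (fL n w tw).
rewrite integral_cst//.
by rewrite [X in (_ * X)%E](lebesgue2_torus : _ = 1%:E) mule1 ltry.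
Qed.

Lemma log_average_ge0 v lam E n : measurable_fun (torus : set plane) v ->
  (exists M, forall w, torus w -> `|v w| <= M) -> 0 <= log_average v lam E n.
Proof.
by move=> mv vM; rewrite -lee_fin log_averageE//; apply: integral_ge0.
Qed.

(** The pointwise cocycle inequality is integrated, and invariance of the measure removes the shift
    by n iterations. The inequality is proved for extended reals and transferred by [fin_leD]. *)
Lemma log_average_subadditive v lam E m n : measurable_fun (torus : set plane) v ->
  (exists M, forall w, torus w -> `|v w| <= M) ->
  log_average v lam E (m + n) <= log_average v lam E m + log_average v lam E n.
Proof.
move=> mv vM.
have fin_leD (a b c : R) A B C : a%:E = A -> b%:E = B -> c%:E = C ->
    (A <= B + C)%E -> a <= b + c.
  by move=> <- <- <-; rewrite -EFinD lee_fin.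
apply: (fin_leD _ _ _ _ _ _ (log_averageE lam E (m + n) mv vM)
  (log_averageE lam E m mv vM) (log_averageE lam E n mv vM)).
have mt := @measurable_torus R.
have mf k : measurable_fun (torus : set plane)
    (fun w : plane => (ln (op_norm (cocycle v lam E k w)))%:E : \bar R).
  by apply/measurable_EFinP; exact: (measurable_ln_op_norm lam E k mv).
have pT := preserves_torus_iter n (@preserves_torus_cat_map R).
have mfT : measurable_fun (torus : set plane) (fun w : plane =>
    (ln (op_norm (cocycle v lam E m (iter n cat_map w))))%:E : \bar R).
  have [mT tT _] := pT.
  apply: (measurable_comp (F := torus : set plane) _ _ (mf m)); first exact: mt.
    by move=> _ [w tw <-]; exact: (tT w tw).
  exact: measurable_funTS mT.
rewrite -(integral_preserves_torus pT (mf m)); last by move=> w _.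
rewrite -ge0_integralD//; apply: ge0_le_integral => //.
- exact: emeasurable_funD.
- by move=> w _; rewrite -EFinD lee_fin; exact: ln_op_norm_cocycleD.
Qed.

Lemma log_average_ge v (c lam E : R) n : C1_torus v ->
  measurable_fun (torus : set plane) v ->
  (exists M, forall w, torus w -> `|v w| <= M) -> 0 < c ->
  (forall w, torus w -> c < dir_deriv unstable_dir v w) -> 0 < lam ->
  n%:R * (ln lam - 80 * ln 2 / c) <= log_average v lam E n.
Proof.
move=> vC1 mv vM c0 vc lam0.
have C0 : 0 <= 80 * ln 2 / c by rewrite divr_ge0 ?mulr_ge0 ?ln_ge0 ?ler1n// ltW.
(* For a negative [ln lam] the bound follows from nonnegativity of the average; otherwise every
   integrand below is nonnegative. *)
have [l0|l0] := ltP (ln lam) 0.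
  apply: le_trans (log_average_ge0 _ _ _ mv vM).
  by rewrite mulr_ge0_le0//; lra.
have mt := @measurable_torus R.
have mf : measurable_fun (torus : set plane)
    (fun w : plane => (ln (op_norm (cocycle v lam E n w)))%:E : \bar R).
  by apply/measurable_EFinP; exact: (measurable_ln_op_norm lam E n mv).
have mg k : measurable_fun (torus : set plane) (log_defect v lam E k : plane -> \bar R).
  apply: ge0_emeasurable_sum => i => [w _ _|_].
    by rewrite lee_fin mulr_ge0// ln_ge0// ler1n.
  apply/measurable_EFinP; apply: measurable_funM; first exact: measurable_cst.
  by apply: measurable_indic; exact: measurable_small_ratio.
have : ((n%:R * ln lam)%:E <=
  (log_average v lam E n)%:E + (n%:R * (80 * ln 2 / c))%:E)%E.
  apply: (@le_trans _ _ (\int[lebesgue2]_(w in (torus : set plane))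
     ((ln (op_norm (cocycle v lam E n w)))%:E +
      \sum_(i < n) log_defect v lam E i w))%E).
    apply: (@le_trans _ _ (\int[lebesgue2]_(w in (torus : set plane)) (n%:R * ln lam)%:E)%E).
      rewrite integral_cst//.
      by rewrite [X in (_ * X)%E](lebesgue2_torus : _ = 1%:E) mule1.
    apply: ge0_le_integral => //.
    - by move=> w _; rewrite lee_fin mulr_ge0.
    - by apply: emeasurable_funD => //; apply: emeasurable_sum.
    - by move=> w tw; exact: log_defect_sum.
  rewrite ge0_integralD//; last 2 first.
  - by move=> w _; apply: sume_ge0 => i _; exact: log_defect_ge0.
  - exact: emeasurable_sum.
  rewrite -log_averageE//; apply: leeD => //.
  rewrite ge0_integral_sum//; last by move=> i w _; exact: log_defect_ge0.
  apply: (@le_trans _ _ (\sum_(i < n) (80 * ln 2 / c)%:E)%E).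
    by apply: lee_sum => i _; exact: integral_log_defect.
  by rewrite sumEFin sumr_const card_ord lee_fin -[leLHS]mulr_natl.
by rewrite -EFinD lee_fin mulrBr; lra.
Qed.

End Limit.

Unset Implicit Arguments.

Theorem theorem1 (R : realType) (v : R * R -> R)
  (v_bounded : exists M : R, forall w : R * R, torus w -> `|v w| <= M)
  (v_measurable : measurable_fun torus v)
  (v_C1 : C1_torus v)
  (v_increasing : exists2 c : R, 0 < c &
     forall w : R * R, torus w -> c < dir_deriv unstable_dir v w) :
  exists2 C0 : R, 0 < C0 &
    forall lam : R, 0 < lam ->
    forall E : R, ln lam - C0 < lyapunov v lam E.
Proof.
have [c c0 vc] := v_increasing.
have l20 : 0 < ln 2 :> R by rewrite ln_gt0// ltr1n.
have C0 : 0 < 80 * ln 2 / c by rewrite divr_gt0// mulr_gt0.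
(* The extra 1 restores the strict inequality, as the limit gives only a weak one. *)
exists (80 * ln 2 / c + 1) => [|lam lam0 E]; first by rewrite addr_gt0.
have mv : measurable_fun
    (torus : set (measurableTypeR R * measurableTypeR R)%type) v := v_measurable.
apply: (@lt_le_trans _ _ (ln lam - 80 * ln 2 / c)).
  by rewrite opprD addrA ltrBlDr ltrDl.
(* The bound passes to [limn] only for a convergent sequence, which Fekete's lemma ensures. *)
rewrite /lyapunov; apply: limr_ge.
  apply: (@subadditive_cvg _ (log_average v lam E)) => [n|m n].
    exact: log_average_ge0.
  exact: log_average_subadditive.
near=> n.
have n0 : (0 : R) < n%:R by rewrite ltr0n; near: n; exists 1%N.
rewrite ler_pdivlMl//.
exact: (log_average_ge E n v_C1 mv v_bounded c0 vc lam0).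
Unshelve. all: by end_near. Qed.
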